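(* For each distortion function $\eta$ there exists a distortion function $\eta'$ such that for each compact Riemannian $2$-manifold $X$ with intrinsic metric $d_g$ we have $$QS(X,d_g,\eta)\subset\overline{R_{\mathrm{loc}}(X)\cap QS(X,d_g,\eta')},$$ where the closure refers to the Gromov--Hausdorff distance.
   Context: A distortion function is a homeomorphism $\eta\colon[0,\infty)\to[0,\infty)$. A homeomorphism $f\colon (X,d_X)\to (Y,d_Y)$ is $\eta$-quasisymmetric if $\frac{d_Y(f(x),f(y))}{d_Y(f(x),f(z))}\le\eta\left(\frac{d_X(x,y)}{d_X(x,z)}\right)$ for all distinct $x,y,z\in X$. Manifolds may have boundary and are connected, so that $d_g$ (the intrinsic metric of the given Riemannian metric $g$) is a finite metric. For a smooth manifold $X$, $R_{\mathrm{loc}}(X)$ is the collection of metrics $d$ on $X$ (identified with the metric spaces $(X,d)$) that are locally isometric to the intrinsic metric $d_{h}$ arising from some Riemannian metric $h$ on $X$; that is, the identity $(X,d_h)\to(X,d)$ is a local isometry: for every $x\in X$ there is $r>0$ such that the identity restricts to an isometric homeomorphism from $B_{d_h}(x,r)$ onto $B_d(x,r)$. For a metric $d$ on $X$ and a distortion function $\eta$, $QS(X,d,\eta)$ is the collection of metric spaces $Y$ such that there exists an $\eta$-quasisymmetric map from $(X,d)$ onto $Y$. A metric space lies in the closure of a collection if it is the Gromov--Hausdorff limit of a sequence of spaces in that collection. *)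

(* Defs.v *)
From HB Require Import structures.
From mathcomp Require Import all_boot all_order all_algebra.
From mathcomp Require Import all_classical all_reals all_analysis.

Set Implicit Arguments.
Unset Strict Implicit.
Unset Printing Implicit Defensive.

Import Order.TTheory GRing.Theory Num.Theory.
Import numFieldNormedType.Exports.

Local Open Scope classical_set_scope.
Local Open Scope ring_scope.

Definition homeo_between (S T : topologicalType) (A : set S) (B : set T)
    (f : S -> T) (g : T -> S) : Prop :=
  [/\ f @` A `<=` B, g @` B `<=` A,
      {in A, cancel f g}, {in B, cancel g f} &
      {within A, continuous f} /\ {within B, continuous g}].

Definition distortion (R : realType) (eta : R -> R) : Prop :=
  exists theta : R -> R,
    homeo_between [set t : R | 0 <= t] [set t : R | 0 <= t] eta theta.

Record metric_on (R : realType) (X : choiceType) := MetricOn {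
  metric_fun :> X -> X -> R ;
  metric_onxx : forall x, metric_fun x x = 0 ;
  metric_on_eq0 : forall x y, metric_fun x y = 0 -> x = y ;
  metric_onC : forall x y, metric_fun x y = metric_fun y x ;
  metric_onD : forall y x z,
    metric_fun x z <= metric_fun x y + metric_fun y z }.

(* A copy of X with the topology of d instead of any topology X may carry. *)
Definition mspace (R : realType) (X : choiceType) (d : metric_on R X) : Type :=
  X.
HB.instance Definition _ (R : realType) (X : choiceType) (d : metric_on R X) :=
  Choice.on (mspace d).
#[warnings="-redundant-canonical-projection"]
HB.instance Definition _ (R : realType) (X : choiceType) (d : metric_on R X) :=
  isMetric.Build R (mspace d)
    (@metric_onxx R X d) (@metric_on_eq0 R X d) (@metric_onC R X d)
    (@metric_onD R X d).

(* [set (metricType R)] is rejected for universe reasons. *)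
Definition space_collection (R : realType) := metricType R -> Prop.

(* Here dX and dY are plain functions: the distance of a Riemannian metric is
   defined below as an infimum, and no proof that it is a metric is needed to
   speak of it. *)
Definition metric_continuous (R : realType) (X Y : Type)
    (dX : X -> X -> R) (dY : Y -> Y -> R) (f : X -> Y) : Prop :=
  forall x (e : R), 0 < e ->
    exists2 r : R, 0 < r & forall y, dX x y < r -> dY (f x) (f y) < e.

Definition metric_homeo (R : realType) (X Y : Type)
    (dX : X -> X -> R) (dY : Y -> Y -> R) (f : X -> Y) : Prop :=
  exists g : Y -> X, [/\ cancel f g, cancel g f,
    metric_continuous dX dY f & metric_continuous dY dX g].

Definition quasisymmetric (R : realType) (X Y : Type)
    (dX : X -> X -> R) (dY : Y -> Y -> R) (eta : R -> R) (f : X -> Y) : Prop :=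
  metric_homeo dX dY f /\
  forall x y z, x <> y -> x <> z -> y <> z ->
    dY (f x) (f y) / dY (f x) (f z) <= eta (dX x y / dX x z).

Definition QS (R : realType) (X : Type) (d : X -> X -> R) (eta : R -> R) :
    space_collection R :=
  fun Y => exists f : X -> Y, quasisymmetric d (@mdist R Y) eta f.

Definition hausdorff_dist (R : realType) (Z : metricType R) (A B : set Z) :
    \bar R :=
  ereal_inf [set r%:E | r in [set r : R |
    [/\ 0 < r, A `<=` \bigcup_(b in B) ball b r &
               B `<=` \bigcup_(a in A) ball a r]]].

Definition isometric (R : realType) (M N : metricType R) (f : M -> N) : Prop :=
  forall x y, mdist (f x) (f y) = mdist x y.

Definition GH_dist (R : realType) (M N : metricType R) : \bar R :=
  ereal_inf [set e | exists (Z : metricType R) (f : M -> Z) (g : N -> Z),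
    [/\ isometric f, isometric g &
        e = hausdorff_dist (range f) (range g)]].

Definition GH_closure (R : realType) (C : space_collection R) :
    space_collection R :=
  fun Y => exists M : nat -> metricType R,
    (forall k, C (M k)) /\ GH_dist (M k) Y @[k --> \oo] --> 0%E.

Definition partials (R : realType) (n : nat) (V : normedModType R)
    (F : 'rV[R]_n -> V) (s : seq 'I_n) : 'rV[R]_n -> V :=
  foldr (fun i (G : 'rV[R]_n -> V) x => 'D_(delta_mx ord0 i) G x) F s.

(* Meant for open U: F is of class C^oo on U. *)
Definition smooth_open (R : realType) (n : nat) (V : normedModType R)
    (U : set 'rV[R]_n) (F : 'rV[R]_n -> V) : Prop :=
  forall (s : seq 'I_n) x, U x -> differentiable (partials F s) x.

Definition smooth_extension (R : realType) (n : nat) (V : normedModType R)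
    (A : set 'rV[R]_n) (f : 'rV[R]_n -> V) (x : 'rV[R]_n)
    (F : 'rV[R]_n -> V) : Prop :=
  exists U : set 'rV[R]_n, [/\ open U, U x, smooth_open U F &
    forall y, A y -> U y -> F y = f y].

(* Smoothness on an arbitrary set A, e.g. a relatively open subset of a
   half-space: f extends smoothly to a neighbourhood of each point of A. *)
Definition smooth_on (R : realType) (n : nat) (V : normedModType R)
    (A : set 'rV[R]_n) (f : 'rV[R]_n -> V) : Prop :=
  forall x, A x -> exists F, smooth_extension A f x F.

(* Indexed by ['I_n] so as to cover n = 0, where it is the whole point. *)
Definition half_space (R : realType) (n : nat) : set 'rV[R]_n :=
  [set x | forall i : 'I_n, i = 0%N :> nat -> 0 <= x ord0 i].

(* The two maps are total functions; only their values on the domain and on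
   the image are relevant. *)
Record chart (R : realType) (n : nat) (X : Type) := Chart {
  chart_dom : set X ;
  chart_map : X -> 'rV[R]_n ;
  chart_inv : 'rV[R]_n -> X }.

Definition chart_im (R : realType) (n : nat) (X : Type) (c : chart R n X) :
    set 'rV[R]_n :=
  chart_map c @` chart_dom c.

Definition is_chart (R : realType) (n : nat) (X : topologicalType)
    (c : chart R n X) : Prop :=
  [/\ open (chart_dom c),
      exists2 O : set 'rV[R]_n,
        open O & chart_im c = O `&` half_space (n := n) &
      homeo_between (chart_dom c) (chart_im c) (chart_map c) (chart_inv c)].

Definition overlap (R : realType) (n : nat) (X : Type) (c c' : chart R n X) :
    set 'rV[R]_n :=
  chart_map c @` (chart_dom c `&` chart_dom c').

Definition transition (R : realType) (n : nat) (X : Type)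
    (c c' : chart R n X) : 'rV[R]_n -> 'rV[R]_n :=
  chart_map c' \o chart_inv c.

(* The smooth structure is given by an atlas, not required to be maximal. *)
Record smooth_manifold (R : realType) (n : nat) := SmoothManifold {
  points :> topologicalType ;
  atlas : set (chart R n points) ;
  manifold_hausdorff : hausdorff_space points ;
  manifold_second_countable : @second_countable points ;
  manifold_connected : connected [set: points] ;
  atlas_chart : forall c, atlas c -> is_chart c ;
  atlas_cover : forall x, exists2 c, atlas c & chart_dom c x ;
  atlas_compatible : forall c c', atlas c -> atlas c' ->
    smooth_on (overlap c c') (transition c c') }.

(* [gram c p] is the Gram matrix at p of the coordinate vector fields of c.
   Tangent vectors are row vectors, ['d F p v = v *m 'J F p], so the Gram
   matrices transform by [G = J G' J^T].  At a boundary point the Jacobian of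
   a smooth extension of the transition map depends on the transition map
   alone. *)
Record riemannian_metric (R : realType) (n : nat) (X : smooth_manifold R n) :=
  RiemannianMetric {
  gram : chart R n X -> 'rV[R]_n -> 'M[R]_n ;
  gram_smooth : forall c, atlas c -> smooth_on (chart_im c) (gram c) ;
  gram_sym : forall c p, atlas c -> chart_im c p -> (gram c p)^T = gram c p ;
  gram_pos : forall c p (v : 'rV[R]_n), atlas c -> chart_im c p -> v != 0 ->
    0 < (v *m gram c p *m v^T) ord0 ord0 ;
  gram_compatible : forall c c' p (F : 'rV[R]_n -> 'rV[R]_n),
    atlas c -> atlas c' -> overlap c c' p ->
    smooth_extension (overlap c c') (transition c c') p F ->
    gram c p = 'J F p *m gram c' (transition c c' p) *m ('J F p)^T }.

(* A C^1 curve on [0, 1] in the image of a chart; one-sided differentiability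
   at 0 and 1 is obtained by restricting curves defined on the whole line. *)
Definition C1_arc (R : realType) (n : nat) (X : Type) (c : chart R n X)
    (u : R -> 'rV[R]_n) : Prop :=
  [/\ forall t, `[0, 1]%classic t -> chart_im c (u t),
      forall t, `[0, 1]%classic t -> derivable u t 1 &
      {within `[0, 1], continuous (derive1 u)}].

Definition arc_length (R : realType) (n : nat) (X : smooth_manifold R n)
    (g : riemannian_metric X) (c : chart R n X) (u : R -> 'rV[R]_n) : R :=
  \int[@lebesgue_measure R]_(t in `[0, 1])
    Num.sqrt ((derive1 u t *m gram g c (u t) *m (derive1 u t)^T) ord0 ord0).

(* [joined g x y l]: some piecewise C^1 curve from x to y has length l.  The
   curve is cut into finitely many pieces, each in the domain of a chart. *)
Inductive joined (R : realType) (n : nat) (X : smooth_manifold R n)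
    (g : riemannian_metric X) : X -> X -> R -> Prop :=
| joined_refl x : joined g x x 0
| joined_arc c u y l :
    atlas c -> C1_arc c u -> joined g (chart_inv c (u 1)) y l ->
    joined g (chart_inv c (u 0)) y (arc_length g c u + l).

Definition intrinsic_dist (R : realType) (n : nat) (X : smooth_manifold R n)
    (g : riemannian_metric X) (x y : X) : R :=
  inf [set l | joined g x y l].

Definition locally_isometric (R : realType) (X : Type) (d d' : X -> X -> R) :
    Prop :=
  forall x, exists r : R, [/\ 0 < r,
    [set y | d x y < r] = [set y | d' x y < r] &
    forall y z, d x y < r -> d x z < r -> d' y z = d y z].

Definition Rloc (R : realType) (n : nat) (X : smooth_manifold R n) :
    space_collection R :=
  fun M => exists d : metric_on R X, M = mspace d /\
    exists h : riemannian_metric X, locally_isometric (intrinsic_dist h) d.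

(* Main.v *)
(* Pull the metric of Y back to a metric rho on X and write d for the intrinsic
   distance.  Let w(s) be the supremum of rho over pairs at d-distance < s.  As
   d is a length metric, w is subadditive, so sqrt(w(d)) is a metric; it is
   quasisymmetric to d with control depending on eta only, and it dominates rho
   at small scales because w(s) = o(sqrt(w(s))).  Hence
   N = rho + eps sqrt(w(d)) is a uniformly quasisymmetric metric close to rho
   which, below a scale s0 that does not depend on the point, is comparable
   to the radial function eps sqrt(w(d)).
   Let B = N-size of the scale s0 and c = B / s0, up to constants.  The metric
   approximating Y is the minimum of c d and of
     inf over p, q of c d(x,p) + N(p,q) + B + c d(q,y),
   that is, paths for c d with at most one jump of cost N + B.  The triangle
   inequality holds because N <= c d + B.  This metric is c d at distances less
   than B, thus locally isometric to the distance of the Riemannian metric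
   c^2 g; it differs from N by at most B; and it is comparable, with absolute
   constants, to min(c d, N), which is quasisymmetric to d. *)

Require Import Defs.
From mathcomp Require Import all_boot all_order all_algebra.
From mathcomp Require Import all_classical all_reals all_analysis.
From mathcomp Require Import ring lra.

Set Implicit Arguments.
Unset Strict Implicit.
Unset Printing Implicit Defensive.

Import Order.TTheory GRing.Theory Num.Theory.
Import numFieldNormedType.Exports.

Local Open Scope classical_set_scope.
Local Open Scope ring_scope.

(** * Moduli and capped metrics *)

Lemma metric_on_ge0 (R : realType) (X : choiceType) (d : metric_on R X) x y :
  0 <= d x y.
Proof.
have := metric_onD d y x x; rewrite metric_onxx (metric_onC d y x).
by move=> ?; lra.
Qed.

Lemma metric_on_gt0 (R : realType) (X : choiceType) (d : metric_on R X) x y :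
  x <> y -> 0 < d x y.
Proof.
move=> xy; rewrite lt_neqAle metric_on_ge0 andbT eq_sym.
by apply/eqP => /metric_on_eq0.
Qed.

Lemma sqrtrD_le (R : rcfType) (a b : R) : 0 <= a -> 0 <= b ->
  Num.sqrt (a + b) <= Num.sqrt a + Num.sqrt b.
Proof.
move=> a0 b0.
rewrite -(@ler_pXn2r _ 2)// ?nnegrE ?addr_ge0 ?sqrtr_ge0//.
rewrite sqrrD !sqr_sqrtr ?addr_ge0//.
by rewrite -addrA [_ *+ 2 + _]addrC addrA lerDl mulrn_wge0// mulr_ge0 ?sqrtr_ge0.
Qed.

Lemma sqrtr_natM_le (R : rcfType) (n : nat) (a : R) : 0 <= a ->
  Num.sqrt (n%:R * a) <= n%:R * Num.sqrt a.
Proof.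
move=> a0; elim: n => [|n IH]; first by rewrite !mul0r sqrtr0.
rewrite -natr1 !mulrDl !mul1r (le_trans (sqrtrD_le _ _)) ?mulr_ge0//.
by rewrite lerD2r.
Qed.

Section Modulus.
Context (R : realType) (X : choiceType) (d rho : metric_on R X) (eta : R -> R).
Context (D : R).
Hypothesis almost_length : forall (x y : X) (s l : R), 0 < s -> 0 < l ->
  d x y < s + l -> exists m, d x m < s /\ d m y < l.
Hypothesis rho_qs : forall x y z, x <> y -> x <> z -> y <> z ->
  rho x y / rho x z <= eta (d x y / d x z).
Hypothesis eta_ge0 : forall t : R, 0 <= t -> 0 <= eta t.
Hypothesis eta_le : forall s t : R, 0 <= s -> s <= t -> eta s <= eta t.
Hypothesis rho_le : forall x y, rho x y <= D.

(* Strict inequality makes the modulus exactly subadditive although points at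
   distance s + l need not have a point at distance s and l between them. *)
Definition modulus (s : R) : R :=
  sup [set r | exists x y, d x y < s /\ r = rho x y].

Lemma le_modulus x y s : d x y < s -> rho x y <= modulus s.
Proof.
move=> xys; apply: ub_le_sup; last by exists x, y.
by exists D => _ [u [v [_ ->]]].
Qed.

Lemma modulus_le s C : 0 <= C -> (forall x y, d x y < s -> rho x y <= C) ->
  modulus s <= C.
Proof.
move=> C0 h; have [[r sr]|e] := pselect ([set r | exists x y, d x y < s /\ r = rho x y] !=set0).
  apply: ge_sup; first by exists r.
  by move=> _ [x [y [xys ->]]]; exact: h.
(* The supremum of an empty set is 0 by convention, hence the hypothesis [0 <= C]. *)
by rewrite /modulus sup_out// => -[] /e.
Qed.

Lemma modulus_ge0 s : 0 <= modulus s.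
Proof.
have [[r [x [y [xys rE]]]]|e] := pselect ([set r | exists x y, d x y < s /\ r = rho x y] !=set0).
  exact: le_trans (metric_on_ge0 rho x y) (le_modulus xys).
by rewrite /modulus sup_out// => -[] /e.
Qed.

Lemma modulus_mono s t : s <= t -> modulus s <= modulus t.
Proof.
move=> st; apply: modulus_le (modulus_ge0 _) _ => x y xys.
exact/le_modulus/(lt_le_trans xys).
Qed.

Lemma modulus0 (s : R) : s <= 0 -> modulus s = 0.
Proof.
move=> s0; apply/eqP; rewrite eq_le modulus_ge0 andbT.
apply: modulus_le => // x y; have := metric_on_ge0 d x y.
by move=> ? ?; exfalso; lra.
Qed.

(** A pair at distance less than [s + l] is cut by [almost_length] at a point [m], and the triangle
    inequality for [rho] adds the two moduli. *)
Lemma modulusD (s l : R) : 0 <= s -> 0 <= l ->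
  modulus (s + l) <= modulus s + modulus l.
Proof.
rewrite le_eqVlt => /predU1P[<-|s0]; first by rewrite add0r lerDr modulus_ge0.
rewrite le_eqVlt => /predU1P[<-|l0]; first by rewrite addr0 lerDl modulus_ge0.
apply: modulus_le; first by rewrite addr_ge0// modulus_ge0.
move=> x y /(almost_length s0 l0)[m [xm my]].
apply: le_trans (metric_onD rho m x y) _.
by apply: lerD; exact: le_modulus.
Qed.

Lemma modulusMn n (s : R) : 0 <= s -> modulus (n%:R * s) <= n%:R * modulus s.
Proof.
move=> s0; elim: n => [|n IH]; first by rewrite !mul0r modulus0.
rewrite -natr1 !mulrDl !mul1r (le_trans (modulusD _ _)) ?mulr_ge0//.
by rewrite lerD2r.
Qed.

(** Provides a reference point at distance comparable to [s] from any centre [y]. One of [x], [z] is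
    at distance at least [s / 2] from [y]; the point is found on the way towards it. *)
Lemma exists_intermediate (x z y : X) (s : R) : x <> z -> 0 < s -> s <= d x z ->
  exists m, s / 4 <= d y m /\ d y m < s.
Proof.
move=> xz s0 sxz.
have [p yp] : exists p, s / 2 <= d y p.
  have [|yx] := leP (s / 2) (d y x); first by exists x.
  exists z; have := metric_onD d y x z; rewrite (metric_onC d x y).
  by move=> ?; lra.
have [m [ym mp]] : exists m, d y m < s / 2 /\ d m p < d y p - s / 4.
  by apply: almost_length; lra.
by exists m; have := metric_onD d m y p; split; lra.
Qed.

Lemma modulus_gt0 (x z : X) (s : R) : x <> z -> 0 < s -> 0 < modulus s.
Proof.
move=> xz s0; have d0 := metric_on_gt0 d xz.
have m0 : 0 < Num.min s (d x z) by rewrite lt_min s0.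
have [|m [h1 h2]] := @exists_intermediate x z x _ xz m0; first by rewrite ge_min lexx orbT.
have xm : x <> m by move=> xm; move: h1; rewrite -xm metric_onxx; lra.
apply: lt_le_trans (metric_on_gt0 rho xm) _; apply: le_modulus.
by apply: lt_le_trans h2 _; rewrite ge_min lexx.
Qed.

(** Compare [rho y1 y2] by quasisymmetry with [rho y1 m], where [m] lies between [s / 4] and [s]
    away from [y1]: the ratio of distances is at most [4 * t], and [rho y1 m] is at most the modulus
    of [s]. *)
Lemma modulus_scale (x z : X) (s t : R) : x <> z -> 0 < s -> s <= d x z -> 0 < t ->
  modulus (t * s) <= (eta (4 * t) + 4 * t) * modulus s.
Proof.
move=> xz s0 sxz t0.
have e0 : 0 <= eta (4 * t) by apply: eta_ge0; lra.
apply: modulus_le => [|y1 y2 y12].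
  by rewrite mulr_ge0 ?modulus_ge0//; lra.
have [<-|yn] := pselect (y1 = y2).
  by rewrite metric_onxx mulr_ge0 ?modulus_ge0//; lra.
have [m [m1 m2]] := exists_intermediate y1 xz s0 sxz.
have w0 := modulus_ge0 s.
have rw := le_modulus m2.
(* Quasisymmetry speaks of distinct points only. If [y2 = m], then [s / 4 <= d y1 m < t * s] forces
   [1 <= 4 * t], so the summand [4 * t] of the factor suffices. *)
have [y2m|y2m] := pselect (y2 = m).
  rewrite y2m (le_trans rw)// ler_peMl//.
  have : s * (4 * t) >= s * 1 by rewrite y2m in y12; lra.
  by rewrite ler_pM2l//; lra.
have y1m : y1 <> m by move=> y1m; move: m1; rewrite y1m metric_onxx; lra.
have r0 := metric_on_gt0 rho y1m.
have d0 := metric_on_gt0 d y1m.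
have := rho_qs yn y1m y2m; rewrite ler_pdivrMr// => /le_trans; apply.
apply: ler_pM => //.
- exact/eta_ge0/divr_ge0/metric_on_ge0/metric_on_ge0.
- exact: ltW.
- apply: (@le_trans _ _ (eta (4 * t))); last by lra.
  apply: eta_le; first exact/divr_ge0/metric_on_ge0/metric_on_ge0.
  rewrite ler_pdivrMr//.
  have : (4 * t) * (s / 4) <= (4 * t) * d y1 m by rewrite ler_pM2l//; lra.
  by lra.
Qed.

(** Fix the scale [d x z] and shrink it by a factor [u]: the factor in [modulus_scale] tends to 0
    with [u], since [eta] takes arbitrarily small values. *)
Lemma modulus_vanishes (x z : X) (e : R) : x <> z -> 0 < e ->
  (forall e : R, 0 < e -> exists2 t : R, 0 < t & eta t < e) ->
  exists2 s, 0 < s & modulus s <= e.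
Proof.
move=> xz e0 eta0; have d0 := metric_on_gt0 d xz.
set s := d x z in d0.
have W0 : 0 <= modulus s by exact: modulus_ge0.
pose e' := e / (modulus s + 1) / 2.
have e'0 : 0 < e' by rewrite /e' !divr_gt0//; lra.
have [t t0 et] := eta0 _ e'0.
pose u := Num.min (t / 4) (e' / 4).
have u0 : 0 < u by rewrite /u lt_min; apply/andP; split; lra.
exists (u * s); first exact: mulr_gt0.
apply: le_trans (modulus_scale xz d0 (lexx _) u0) _.
have u1 : u <= t / 4 by rewrite ge_min lexx.
have u2 : u <= e' / 4 by rewrite ge_min lexx orbT.
have h : eta (4 * u) + 4 * u <= 2 * e'.
  have : eta (4 * u) <= eta t by apply: eta_le; lra.
  by lra.
have -> : e = 2 * e' * (modulus s + 1).
  by rewrite /e'; field; apply: lt0r_neq0; lra.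
apply: ler_pM => //; last by lra.
by have := eta_ge0 (t := 4 * u); lra.
Qed.

(** * The gauge, called N in the overview *)

Section Gauge.
Context (eps : R) (eps_ge0 : 0 <= eps).

Definition gauge (x y : X) : R := rho x y + eps * Num.sqrt (modulus (d x y)).

Lemma gauge_sqrt_ge0 x y : 0 <= eps * Num.sqrt (modulus (d x y)).
Proof. by rewrite mulr_ge0// sqrtr_ge0. Qed.

Lemma gauge_xx x : gauge x x = 0.
Proof. by rewrite /gauge !metric_onxx modulus0// sqrtr0 mulr0 addr0. Qed.

Lemma gauge_eq0 x y : gauge x y = 0 -> x = y.
Proof.
move=> h; apply: (metric_on_eq0 (m := rho)).
have := gauge_sqrt_ge0 x y; have := metric_on_ge0 rho x y.
by move: h; rewrite /gauge => ? ? ?; lra.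
Qed.

Lemma gaugeC x y : gauge x y = gauge y x.
Proof. by rewrite /gauge metric_onC (metric_onC d). Qed.

Lemma gaugeD y x z : gauge x z <= gauge x y + gauge y z.
Proof.
rewrite /gauge addrACA -mulrDr lerD ?metric_onD// ler_wpM2l//.
apply: le_trans (sqrtrD_le (modulus_ge0 _) (modulus_ge0 _)).
apply: ler_wsqrtr; apply: le_trans (modulusD _ _); rewrite ?metric_on_ge0//.
exact/modulus_mono/metric_onD.
Qed.

Definition gauge_metric : metric_on R X :=
  MetricOn gauge_xx gauge_eq0 gaugeC gaugeD.

(** The two summands are controlled separately, the first by [eta] and the second by the square root
    of the factor in [modulus_scale]. The bound is free of [eps] and [D], so the final distortion
    depends on [eta] alone. *)
Lemma gauge_qs (x y z : X) : x <> y -> x <> z -> y <> z ->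
  gauge x y / gauge x z <= eta (d x y / d x z) +
    Num.sqrt (eta (4 * (d x y / d x z)) + 4 * (d x y / d x z)).
Proof.
move=> xy xz yz; set t := d x y / d x z.
have r0 := metric_on_gt0 rho xz; have d0 := metric_on_gt0 d xz.
have t0 : 0 < t by rewrite divr_gt0// metric_on_gt0.
have g0 : 0 < gauge x z by rewrite /gauge ltr_wpDr// gauge_sqrt_ge0.
rewrite ler_pdivrMr// /gauge.
set q := Num.sqrt (_ + _).
have q0 : 0 <= q by rewrite sqrtr_ge0.
have e0 : 0 <= eta t by apply: eta_ge0; exact: ltW.
have h1 : rho x y <= eta t * rho x z.
  by have := rho_qs xy xz yz; rewrite ler_pdivrMr.
have h2 : eps * Num.sqrt (modulus (d x y)) <= q * (eps * Num.sqrt (modulus (d x z))).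
  rewrite mulrCA ler_wpM2l// /q -sqrtrM; last first.
    by rewrite addr_ge0// ?eta_ge0//; lra.
  apply: ler_wsqrtr.
  have -> : d x y = t * d x z by rewrite /t divfK// gt_eqF.
  exact: modulus_scale xz d0 (lexx _) t0.
have := gauge_sqrt_ge0 x z.
move: h1 h2; set A := rho x y; set A' := eps * _; set C := eps * _ => h1 h2 C0.
have : 0 <= eta t * C by rewrite mulr_ge0.
have : 0 <= q * rho x z by rewrite mulr_ge0// ltW.
by rewrite mulrDr !mulrDl => ? ?; lra.
Qed.

(* At scale s0 both summands of the gauge are at most b. *)
Lemma gauge_coarse_lipschitz s0 (b := eps * Num.sqrt (modulus s0)) :
  0 < s0 -> modulus s0 <= eps ^+ 2 ->
  forall x y, gauge x y <= 2 * b / s0 * d x y + 2 * b.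
Proof.
move=> s00 ms x y.
set n := (Num.truncn (d x y / s0)).+1.
have q0 : 0 <= d x y / s0 by rewrite divr_ge0 ?metric_on_ge0// ltW.
have /andP[n1 n2] : (Num.truncn (d x y / s0))%:R <= d x y / s0 < n%:R.
  exact: truncn_itv.
have dn : d x y < n%:R * s0 by rewrite -ltr_pdivrMr.
have nle : n%:R <= d x y / s0 + 1 by rewrite /n -natr1; lra.
have m0 := modulus_ge0 s0.
have b1 : modulus s0 <= b.
  rewrite /b -[leLHS]sqr_sqrtr// expr2 ler_wpM2r ?sqrtr_ge0//.
  by rewrite -(@ler_pXn2r _ 2)// ?nnegrE ?sqrtr_ge0// sqr_sqrtr.
have h1 : rho x y <= n%:R * b.
  apply: le_trans (le_modulus dn) _; apply: le_trans (modulusMn n (ltW s00)) _.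
  by rewrite ler_wpM2l.
have h2 : eps * Num.sqrt (modulus (d x y)) <= n%:R * b.
  rewrite /b mulrCA ler_wpM2l//; apply: le_trans (sqrtr_natM_le _ m0).
  by apply/ler_wsqrtr/(le_trans (modulus_mono (ltW dn)))/modulusMn/ltW.
have b0 : 0 <= b by rewrite mulr_ge0// sqrtr_ge0.
have : n%:R * b <= (d x y / s0 + 1) * b by rewrite ler_wpM2r.
have -> : 2 * b / s0 * d x y = 2 * (d x y / s0 * b) by field; apply: lt0r_neq0; lra.
by rewrite /gauge mulrDl => ?; lra.
Qed.

(** At most [2 * (s0 / d x y)] steps of length [d x y] cover [s0], so subadditivity of the square
    root of the modulus bounds [b] by that many times the second summand of the gauge. *)
Lemma gauge_ge_small s0 (b := eps * Num.sqrt (modulus s0)) (x y : X) :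
  x <> y -> d x y <= s0 -> b / (2 * s0) * d x y <= gauge x y.
Proof.
move=> xy ds; have d0 := metric_on_gt0 d xy.
have s00 : 0 < s0 by lra.
set n := (Num.truncn (s0 / d x y)).+1.
have q1 : 1 <= s0 / d x y by rewrite ler_pdivlMr// mul1r.
have /andP[n1 n2] : (Num.truncn (s0 / d x y))%:R <= s0 / d x y < n%:R.
  by apply: truncn_itv; lra.
have nle : n%:R <= 2 * (s0 / d x y) by rewrite /n -natr1; lra.
have sn : s0 <= n%:R * d x y by rewrite -ler_pdivrMr// ltW.
have w0 := modulus_ge0 (d x y).
have h : Num.sqrt (modulus s0) <= n%:R * Num.sqrt (modulus (d x y)).
  apply: le_trans (sqrtr_natM_le _ w0).
  exact/ler_wsqrtr/(le_trans (modulus_mono sn))/modulusMn/ltW.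
have h' : b <= 2 * (s0 / d x y) * (eps * Num.sqrt (modulus (d x y))).
  rewrite /b mulrCA ler_wpM2l// (le_trans h)// ler_wpM2r ?sqrtr_ge0//.
have -> : b / (2 * s0) * d x y = b / (2 * (s0 / d x y)) by field; rewrite !lt0r_neq0.
rewrite ler_pdivrMr; last by lra.
apply: le_trans h' _; rewrite mulrC ler_wpM2r//; first by lra.
by rewrite /gauge lerDr metric_on_ge0.
Qed.

Lemma gauge_ge_large s0 (b := eps * Num.sqrt (modulus s0)) (x y : X) :
  s0 <= d x y -> b <= gauge x y.
Proof.
move=> sd; apply: ler_wpDl; first exact: metric_on_ge0.
by rewrite ler_wpM2l//; apply/ler_wsqrtr/modulus_mono.
Qed.

End Gauge.
End Modulus.

(** * Capping a multiple of d by paths with one jump *)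

Section CappedMetric.
Context (R : realType) (X : choiceType) (d N : metric_on R X) (c B : R).
Hypotheses (c_gt0 : 0 < c) (B_gt0 : 0 < B).
Hypothesis N_coarse : forall x y, N x y <= c * d x y + B.

Definition jump_set (x y : X) : set R :=
  [set r | exists p q, r = c * d x p + N p q + B + c * d q y].

Definition jump (x y : X) : R := inf (jump_set x y).

Definition capped (x y : X) : R := Num.min (c * d x y) (jump x y).

Let d_ge0 x y : 0 <= c * d x y.
Proof. by rewrite mulr_ge0 ?metric_on_ge0// ltW. Qed.

Let d_tri y x z : c * d x z <= c * d x y + c * d y z.
Proof. by rewrite -mulrDr ler_pM2l// metric_onD. Qed.

Lemma jump_le x y p q : jump x y <= c * d x p + N p q + B + c * d q y.
Proof.
apply: ge_inf; last by exists p, q.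
exists 0 => _ [p' [q' ->]]; have := d_ge0 x p'; have := d_ge0 q' y.
by have := metric_on_ge0 N p' q'; move: B_gt0 => *; lra.
Qed.

Lemma le_jump x y r : (forall p q, r <= c * d x p + N p q + B + c * d q y) ->
  r <= jump x y.
Proof.
move=> h; apply: lb_le_inf => [|_ [p [q ->]]]; last exact: h.
by exists (c * d x x + N x x + B + c * d x y), x, x.
Qed.

Lemma jump_ge x y : B <= jump x y.
Proof.
apply: le_jump => p q; have := d_ge0 x p; have := d_ge0 q y.
by have := metric_on_ge0 N p q; move: B_gt0 => *; lra.
Qed.

Lemma jump_le_gauge x y : jump x y <= N x y + B.
Proof.
by have := jump_le x y x y; rewrite !metric_onxx mulr0 addr0 add0r.
Qed.

(** By [N_coarse] each of the two walks is as long as its [N]-distance up to an error [B]; the toll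
    of the jump absorbs one of the two errors. *)
Lemma jump_ge_gauge x y : N x y - B <= jump x y.
Proof.
apply: le_jump => p q.
have := N_coarse x p; have := N_coarse q y.
have := metric_onD N p x y; have := metric_onD N q p y.
by move=> *; move: B_gt0 => *; lra.
Qed.

Lemma capped_xx x : capped x x = 0.
Proof.
rewrite /capped metric_onxx mulr0 min_l//.
by apply: le_trans (jump_ge x x); exact: ltW.
Qed.

Lemma capped_eq0 x y : capped x y = 0 -> x = y.
Proof.
move=> h; apply: (metric_on_eq0 (m := d)); apply/eqP.
rewrite eq_le metric_on_ge0 andbT leNgt; apply/negP => d0.
have : 0 < capped x y by rewrite /capped lt_min mulr_gt0//= (lt_le_trans B_gt0 (jump_ge _ _)).
by rewrite h ltxx.
Qed.

Lemma jumpC_le x y : jump x y <= jump y x.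
Proof.
apply: le_jump => p q; apply: le_trans (jump_le x y q p) _.
by rewrite (metric_onC d x q) (metric_onC N q p) (metric_onC d p y); move: B_gt0 => *; lra.
Qed.

Lemma cappedC x y : capped x y = capped y x.
Proof.
by rewrite /capped metric_onC; congr Num.min; apply/eqP; rewrite eq_le !jumpC_le.
Qed.

Lemma jump_triangle_d y x z : jump x z <= c * d x y + jump y z.
Proof.
rewrite -lerBlDl; apply: le_jump => p q.
have := jump_le x z p q; have := d_tri y x p; move: B_gt0 => *; lra.
Qed.

(* Two successive jumps are merged into one; coarse Lipschitz continuity of N
   makes the toll B of the second jump pay for the detour in between. *)
Lemma jump_triangle y x z : jump x z <= jump x y + jump y z.
Proof.
rewrite -lerBlDr; apply: le_jump => p q.
rewrite lerBlDr addrC -lerBlDr; apply: le_jump => p' q'.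
have := jump_le x z p q'; have := d_tri y q p'.
have := N_coarse q p'.
have := metric_onD N q p q'; have := metric_onD N p' q q'.
by move=> *; move: B_gt0 => *; lra.
Qed.

Lemma cappedD y x z : capped x z <= capped x y + capped y z.
Proof.
rewrite /capped {2 3}/Num.min; case: ifP => _; case: ifP => _; rewrite ge_min.
- by rewrite d_tri.
- by rewrite jump_triangle_d orbT.
(* A jump followed by a walk is, read backwards, a walk followed by a jump. *)
- apply/orP; right; apply: le_trans (jumpC_le _ _) _.
  rewrite addrC (metric_onC d y z); apply: le_trans (jump_triangle_d y z x) _.
  by rewrite lerD2l jumpC_le.
- by rewrite jump_triangle orbT.
Qed.

Definition capped_metric : metric_on R X :=
  MetricOn capped_xx capped_eq0 cappedC cappedD.

(** A jump costs at least [B], so a smaller value can only come from walking. *)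
Lemma capped_local x y : capped x y < B -> capped x y = c * d x y.
Proof.
rewrite /capped minEle; case: ifP => // _ h.
by move: (jump_ge x y); rewrite leNgt h.
Qed.

Lemma capped_local_d x y : c * d x y <= B -> capped x y = c * d x y.
Proof.
by move=> h; rewrite /capped min_l// (le_trans h)// jump_ge.
Qed.

Lemma capped_le_gauge x y : capped x y <= N x y + B.
Proof. by rewrite ge_min jump_le_gauge orbT. Qed.

Lemma capped_ge_gauge x y : N x y - B <= capped x y.
Proof.
by rewrite le_min jump_ge_gauge andbT; have := N_coarse x y; move: B_gt0 => *; lra.
Qed.

(** The radius [B / 2] works at every point: two points of such a ball are less than [B] apart,
    where jumps do not shorten the way. *)
Lemma capped_locally_isometric : locally_isometric (fun x y => c * d x y) capped.
Proof.
have B0 := B_gt0.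
move=> x; exists (B / 2); split; first by lra.
  apply/seteqP; split => y /= h.
    by rewrite capped_local_d//; lra.
  by rewrite -capped_local//; lra.
move=> y z xy xz; apply: capped_local_d.
by have := d_tri x y z; rewrite (metric_onC d y x); lra.
Qed.

Lemma capped_comparable x y :
  (c * d x y <= B -> c * d x y / 4 <= N x y) ->
  (B <= c * d x y -> B / 2 <= N x y) ->
  Num.min (c * d x y) (N x y) / 3 <= capped x y <= 4 * Num.min (c * d x y) (N x y).
Proof.
move=> h1 h2; apply/andP; split.
  rewrite /capped le_min; apply/andP; split.
    have : Num.min (c * d x y) (N x y) <= c * d x y by rewrite ge_min lexx.
    by have := d_ge0 x y; move: B_gt0 => *; lra.
  have : Num.min (c * d x y) (N x y) <= N x y by rewrite ge_min lexx orbT.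
  by have := jump_ge x y; have := jump_ge_gauge x y; move: B_gt0 => *; lra.
rewrite -ler_pdivrMl// mulrC le_min.
have a1 : capped x y <= c * d x y by rewrite ge_min lexx.
have a2 := capped_le_gauge x y.
have := d_ge0 x y.
have [/h1|/ltW/h2] := leP (c * d x y) B => h ?; apply/andP; split; move: B_gt0 => *; lra.
Qed.

End CappedMetric.

(** * Gromov-Hausdorff approximation *)

Section Gluing.
Context (R : realType) (X : choiceType) (d : metric_on R X) (Y : metricType R).
Context (f : X -> Y) (g : Y -> X) (delta : R).
Hypotheses (fK : cancel f g) (gK : cancel g f) (delta_gt0 : 0 < delta).
Hypothesis close : forall x y, `|d x y - mdist (f x) (f y)| <= delta.

(** The distance across the disjoint union of [X] and [Y]: walk in [X], cross from some [z] to [f z]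
    at cost [delta], walk in [Y]. *)
Definition bridge (x : X) (y : Y) : R :=
  inf [set r | exists z, r = d x z + delta + mdist (f z) y].

Let mtri (b a c : Y) : mdist a c <= mdist a b + mdist b c.
Proof. exact: metric_triangle. Qed.

Let closeP x y : d x y <= mdist (f x) (f y) + delta /\
  mdist (f x) (f y) <= d x y + delta.
Proof. by have := close x y; rewrite ler_norml => /andP[? ?]; split; lra. Qed.

Lemma bridge_le x y z : bridge x y <= d x z + delta + mdist (f z) y.
Proof.
apply: ge_inf; last by exists z.
exists 0 => _ [p ->].
have d0 := delta_gt0; have := metric_on_ge0 d x p; have := mdist_ge0 (f p) y.
by move=> *; lra.
Qed.

Lemma le_bridge x y r : (forall z, r <= d x z + delta + mdist (f z) y) ->
  r <= bridge x y.
Proof.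
move=> h; apply: lb_le_inf => [|_ [z ->]]; last exact: h.
by exists (d x x + delta + mdist (f x) y), x.
Qed.

Lemma bridge_gt0 x y : 0 < bridge x y.
Proof.
apply: (lt_le_trans delta_gt0); apply: le_bridge => z.
by have := metric_on_ge0 d x z; have := mdist_ge0 (f z) y; move=> *; lra.
Qed.

Definition glued (a b : (X + Y)%type) : R :=
  match a, b with
  | inl x, inl x' => d x x'
  | inl x, inr y => bridge x y
  | inr y, inl x => bridge x y
  | inr y, inr y' => mdist y y'
  end.

Lemma glued_xx a : glued a a = 0.
Proof. by case: a => [x|y] /=; rewrite ?metric_onxx ?mdistxx. Qed.

Lemma glued_eq0 a b : glued a b = 0 -> a = b.
Proof.
case: a b => [x|y] [x'|y'] /=.
- by move/metric_on_eq0 ->.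
- by have := bridge_gt0 x y' => + h; rewrite h ltxx.
- by have := bridge_gt0 x' y => + h; rewrite h ltxx.
- by move/mdist_positivity ->.
Qed.

Lemma gluedC a b : glued a b = glued b a.
Proof. by case: a b => [x|y] [x'|y'] //=; [exact: metric_onC|exact: metric_sym]. Qed.

(** Closeness of the two metrics enters only when the path crosses twice, from one space to the
    other and back: the two tolls [delta] then pay for the discrepancy, which is at most [delta]. *)
Lemma gluedD b a c : glued a c <= glued a b + glued b c.
Proof.
have d0 := delta_gt0.
case: a b c => [x|y] [x'|y'] [x''|y''] /=.
- exact: metric_onD.
- rewrite -lerBlDl; apply: le_bridge => z.
  by have := bridge_le x y'' z; have := metric_onD d x' x z; move=> *; lra.
- rewrite -lerBlDr; apply: le_bridge => z.
  rewrite lerBlDr addrC -lerBlDr; apply: le_bridge => z'.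
  have := metric_onD d z x x''; have := metric_onD d z' z x''.
  have := (closeP z z').1; have := mtri y' (f z) (f z').
  by rewrite (metric_onC d z' x'') (metric_sym y') => *; lra.
- rewrite -lerBlDr; apply: le_bridge => z.
  by have := bridge_le x y'' z; have := mtri y' (f z) y''; move=> *; lra.
- rewrite addrC (metric_onC d x' x'') -lerBlDl; apply: le_bridge => z.
  by have := bridge_le x'' y z; have := metric_onD d x' x'' z; move=> *; lra.
- rewrite -lerBlDr; apply: le_bridge => z.
  rewrite lerBlDr addrC -lerBlDr; apply: le_bridge => z'.
  have := mtri (f z) y y''; have := mtri (f z') (f z) y''.
  have := (closeP z z').2; have := metric_onD d x' z z'.
  by rewrite (metric_onC d z x') (metric_sym y (f z)) => *; lra.
- rewrite addrC -lerBlDr; apply: le_bridge => z.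
  have := bridge_le x'' y z; have := mtri y' (f z) y.
  by rewrite (metric_sym y' y) => *; lra.
- exact: mtri.
Qed.

Definition glued_metric : metric_on R (X + Y)%type :=
  MetricOn glued_xx glued_eq0 gluedC gluedD.

Lemma GH_dist_le : (GH_dist (mspace d) Y <= (2 * delta)%:E)%E.
Proof.
pose Z : metricType R := mspace glued_metric.
pose i : mspace d -> Z := fun x => inl x.
pose j : Y -> Z := fun y => inr y.
have d0 := delta_gt0.
(* The bridge from [x] to [f x] costs at most [delta]; doubling makes the inequality strict, as the
   open balls in [hausdorff_dist] require. *)
have br x : bridge x (f x) < 2 * delta.
  by have := bridge_le x (f x) x; rewrite metric_onxx mdistxx => *; lra.
apply: (@le_trans _ _ (hausdorff_dist (range i) (range j))).
  by apply: ereal_inf_lbound; exists Z, i, j; split.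
apply: ereal_inf_lbound; exists (2 * delta) => //; split; first by lra.
- move=> _ [x _ <-]; exists (j (f x)); first by exists (f x).
  by rewrite ballEmdist /=; exact: br.
- move=> _ [y _ <-]; exists (i (g y)); first by exists (g y).
  by rewrite ballEmdist /=; have := br (g y); rewrite gK.
Qed.

End Gluing.

Lemma GH_dist_ge0 (R : realType) (M N : metricType R) : (0 <= GH_dist M N)%E.
Proof.
apply: le_ereal_inf_tmp => _ [Z [i [j [_ _ ->]]]].
by apply: le_ereal_inf_tmp => _ [r [r0 _ _] <-]; rewrite lee_fin ltW.
Qed.

Lemma GH_closureP (R : realType) (X : choiceType) (C : space_collection R)
    (Y : metricType R) :
  (forall e : R, 0 < e ->
    exists2 d : metric_on R X, C (mspace d) & (GH_dist (mspace d) Y <= e%:E)%E) ->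
  GH_closure C Y.
Proof.
move=> h.
have h' k : exists d : metric_on R X,
    C (mspace d) /\ (GH_dist (mspace d) Y <= k.+1%:R^-1%:E)%E.
  by have [|d Cd hd] := h k.+1%:R^-1; [rewrite invr_gt0|exists d].
have [d dP] := choice h'.
exists (fun k => mspace (d k)); split=> [k|]; first exact: (dP k).1.
apply: (@squeeze_cvge _ _ _ _ (cst 0%E) _ (fun k => k.+1%:R^-1%:E)).
- by apply: nearW => k; rewrite GH_dist_ge0 (dP k).2.
- exact: cvg_cst.
- exact: cvge_harmonic.
Qed.

(** * Distortion functions *)

Section Distortion.
Context (R : realType).
Implicit Types (eta phi : R -> R) (s t e : R).

Lemma distortion_increasing eta : distortion eta ->
  [/\ eta 0 = 0, {within [set t : R | 0 <= t], continuous eta},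
      forall s t, 0 <= s -> 0 <= t -> (eta s <= eta t) = (s <= t) &
      forall e, 0 < e -> exists2 t, 0 < t & eta t < e].
Proof.
move=> [theta [eta_pos theta_pos etaK thetaK [ceta _]]].
have eta_ge0 t : 0 <= t -> 0 <= eta t by move=> t0; apply: eta_pos; exists t.
have theta_ge0 t : 0 <= t -> 0 <= theta t by move=> t0; apply: theta_pos; exists t.
have IE : [set` `[0, +oo[ : interval R] = [set t : R | 0 <= t].
  by apply/seteqP; split => t /=; rewrite in_itv/= andbT.
have inj : {in `[0 : R, +oo[ &, injective eta}.
  move=> s t; rewrite !in_itv/= !andbT => s0 t0.
  by apply: (can_in_inj etaK); rewrite inE.
have ceta' : {within [set` `[0, +oo[ : interval R], continuous eta} by rewrite IE.
have eta_theta t : 0 <= t -> eta (theta t) = t by move=> t0; apply: thetaK; rewrite inE.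
have mono : {in `[0 : R, +oo[ &, {mono eta : x y / x <= y}}.
  have [h|dec] := itv_continuous_inj_mono ceta' inj; first exact: le_mono_in h.
  (* A decreasing [eta] would be bounded by [eta 0], but it attains the value [eta 0 + 1]. *)
  move: dec => /le_nmono_in dec.
  have e1 : 0 <= eta 0 + 1 by rewrite addr_ge0// eta_ge0.
  have := dec (theta (eta 0 + 1)) 0; rewrite !in_itv/= lexx theta_ge0//=.
  by move=> /(_ isT isT); rewrite eta_theta// gerDl ler10.
have mono' s t : 0 <= s -> 0 <= t -> (eta s <= eta t) = (s <= t).
  by move=> s0 t0; apply: mono; rewrite in_itv/= andbT.
have eta0 : eta 0 = 0.
  apply/eqP; rewrite eq_le eta_ge0// andbT.
  by rewrite -[leRHS](eta_theta 0 (lexx 0)) mono' ?theta_ge0.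
split => // e e0; exists (theta (e / 2)); last by rewrite eta_theta; lra.
rewrite lt_neqAle theta_ge0 ?andbT; last by lra.
apply/eqP => h; have := eta_theta (e / 2); rewrite -h eta0 => /(_ _).
by have e2 : 0 <= e / 2 by [lra]; move=> /(_ e2); lra.
Qed.

(** The bound [t <= phi t] makes [phi] unbounded, so the intermediate value theorem gives
    surjectivity; continuity of the inverse follows from monotonicity. *)
Lemma increasing_distortion phi : phi 0 = 0 ->
  {within [set t : R | 0 <= t], continuous phi} ->
  (forall s t, 0 <= s -> 0 <= t -> (phi s <= phi t) = (s <= t)) ->
  (forall t, 0 <= t -> t <= phi t) -> distortion phi.
Proof.
move=> phi0 cphi mono ge.
have surj s : 0 <= s -> exists t, 0 <= t /\ phi t = s.
  move=> s0.
  have [||t] := @IVT R phi 0 s s s0.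
  - apply: continuous_subspaceW cphi => t /=; by rewrite in_itv/= => /andP[].
  - by rewrite phi0 ge_min s0/= le_max ge// orbT.
  - by rewrite in_itv/= => /andP[t0 _] <-; exists t.
pose theta s := if pselect (0 <= s) is left s0 then sval (cid (surj s s0)) else 0.
have thetaP s : 0 <= s -> 0 <= theta s /\ phi (theta s) = s.
  by move=> s0; rewrite /theta; case: pselect => // s0'; case: cid.
exists theta; split.
- by move=> _ [t t0 <-]; exact: le_trans t0 (ge t t0).
- by move=> _ [t t0 <-]; exact: (thetaP t t0).1.
- move=> t /[!inE] t0; have pt0 : 0 <= phi t by exact: le_trans t0 (ge t t0).
  have [h1 h2] := thetaP _ pt0.
  by apply/eqP; rewrite eq_le -(mono _ t)// -(mono t)// h2 lexx.
- by move=> t /[!inE] /thetaP[].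
split=> //; apply/subspace_continuousP => s s0.
have [a0 ae] := thetaP _ s0.
have lt_mono x y : 0 <= x -> 0 <= y -> (phi x < phi y) = (x < y).
  by move=> x0 y0; rewrite !ltNge mono.
apply/cvgrPdist_lt => e e0.
have ub : phi (theta s + e) > s by rewrite -[ltLHS]ae lt_mono; lra.
(* If [theta s < e], then [theta s - e] is negative and lies below every value of [theta] on the
   half-line, so no lower bracket for [x] is called for. *)
have lb : theta s < e \/ 0 <= theta s - e /\ phi (theta s - e) < s.
  have [|h] := ltP (theta s) e; first by left.
  by right; split; [lra|rewrite -[ltRHS]ae lt_mono; lra].
have n1 : \forall x \near within [set t | 0 <= t] (nbhs s), x < phi (theta s + e).
  by apply: cvg_within; exact: lt_nbhsl.
have n2 : \forall x \near within [set t | 0 <= t] (nbhs s), 0 <= x.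
  by apply: withinT.
have n3 : \forall x \near within [set t | 0 <= t] (nbhs s),
    theta s < e \/ 0 <= theta s - e /\ phi (theta s - e) < x.
  case: lb => [lb|[lb0 lb]]; first by apply: nearW; left.
  by apply: cvg_within; apply: filterS (lt_nbhsr lb) => x ?; right.
near=> x.
have x0 : 0 <= x by near: x.
have [b0 be] := thetaP _ x0.
have xub : x < phi (theta s + e) by near: x.
have h1 : theta x < theta s + e by rewrite -lt_mono ?be//; lra.
change (`|theta s - theta x| < e); rewrite ltr_norml; apply/andP; split; first by lra.
suff : theta s - e < theta x by lra.
have [|[c0 h]] : theta s < e \/ 0 <= theta s - e /\ phi (theta s - e) < x by near: x.
  by lra.
by rewrite -lt_mono// be.
Unshelve. all: by end_near. Qed.

(** The summand [t] controls [c * d], the other two control the gauge as in [gauge_qs], and 12 is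
    the product of the constants 3 and 4 of [capped_comparable]. The summand [t] also gives the
    growth asked for by [increasing_distortion]. *)
Definition enlarged eta t : R :=
  12 * (t + eta t + Num.sqrt (eta (4 * t) + 4 * t)).

Lemma enlarged_distortion eta : distortion eta -> distortion (enlarged eta).
Proof.
move=> /distortion_increasing[eta0 ceta mono _].
have eta_ge0 t : 0 <= t -> 0 <= eta t by move=> t0; rewrite -eta0 mono.
have lt_mono s t : 0 <= s -> 0 <= t -> s < t ->
    enlarged eta s < enlarged eta t.
  move=> s0 t0 st; rewrite /enlarged ltr_pM2l// ltr_leD//.
    by rewrite ltr_leD// mono// ltW.
  by apply: ler_wsqrtr; apply: lerD; rewrite ?mono; lra.
apply: increasing_distortion.
- by rewrite /enlarged mulr0 !eta0 !addr0 sqrtr0 addr0 mulr0.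
- apply/subspace_continuousP => t t0 /=.
  have /subspace_continuousP ceta' := ceta.
  have idc : x @[x --> within [set t | 0 <= t] (nbhs t)] --> t by exact: cvg_within.
  have mulc : 4 * x @[x --> within [set t | 0 <= t] (nbhs t)] --> 4 * t.
    by apply: cvgMr.
  apply: cvgM; first exact: cvg_cst.
  apply: cvgD; first by apply: cvgD => //; exact: ceta'.
  apply: continuous_cvg; first exact: sqrt_continuous. apply: cvgD => //.
  have t4 : 0 <= 4 * t by rewrite mulr_ge0.
  apply: (@cvg_comp _ _ _ (fun x => 4 * x) eta _ _ _ _ (ceta' (4 * t) t4)).
  move=> A /mulc A4; pose F := within [set t : R | 0 <= t] (nbhs t).
  have FT : F [set t | 0 <= t] by exact: withinT.
  apply: (@filterS2 _ F _ _ _ _ _ A4 FT) => x /= A4x x0.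
  by apply: A4x => //; exact: mulr_ge0.
- move=> s t s0 t0; apply/idP/idP.
    by apply: contraTT; rewrite -!ltNge; exact: lt_mono.
  by rewrite le_eqVlt => /predU1P[->//|/(lt_mono _ _ s0 t0)/ltW].
- move=> t t0; rewrite /enlarged; have := eta_ge0 t t0.
  have := sqrtr_ge0 (eta (4 * t) + 4 * t); lra.
Qed.

End Distortion.

(** * Arcs *)

Lemma affine_derive1 (R : realType) (a k : R) :
  derive1 (fun s : R => a + k * s) = cst k.
Proof.
apply/funext => s; rewrite derive1E deriveD// ?derive_cst ?add0r.
by rewrite deriveM// derive_cst derive_id scaler0 addr0 /GRing.scale/= mulr1.
Qed.

Lemma affine_continuous (R : realType) (a k : R) :
  continuous (fun s : R => a + k * s).
Proof.
move=> s; apply: cvgD; first exact: cvg_cst.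
by apply: cvgM; [exact: cvg_cst|exact: cvg_id].
Qed.

Lemma reparam_derivable (R : realType) (V : normedModType R) (u : R -> V)
    (a k s : R) : derivable u (a + k * s) 1 ->
  derivable (fun s => u (a + k * s)) s 1 /\
  derive1 (fun s => u (a + k * s)) s = k *: derive1 u (a + k * s).
Proof.
move=> du.
have da : differentiable (fun s : R => a + k * s) s.
  by apply/derivable1_diffP; apply: derivableD => //; apply: derivableM.
have du' : differentiable u (a + k * s) by apply/derivable1_diffP.
have dua : differentiable (u \o (fun s => a + k * s)) s by exact: differentiable_comp.
split; first exact/derivable1_diffP.
rewrite -/(u \o (fun s => a + k * s)) derive1E'// diff_comp//= -derive1E'//.
rewrite affine_derive1 /= (derive1E' du') -linearZ /=.
by congr ('d u _ _); rewrite -[LHS]mulr1.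
Qed.

Lemma within_reparam_continuous (R : realType) (T : topologicalType) (u : R -> T)
    (a k : R) (A B : set R) : {within B, continuous u} ->
  (forall s, A s -> B (a + k * s)) ->
  {within A, continuous (fun s => u (a + k * s))}.
Proof.
move=> /subspace_continuousP uc AB; apply/subspace_continuousP => s As.
move=> W /(uc _ (AB _ As)); rewrite /within/= => uW.
have ks := affine_continuous uW.
by apply: (@filterS _ (nbhs s) _ _ _ _ ks) => r h /AB; exact: h.
Qed.

Lemma Rintegral_reparam (R : realType) (w : R -> R) (a k : R) : 0 <= k ->
  {within `[a, a + k], continuous w} ->
  \int[@lebesgue_measure R]_(s in `[0, 1]) (k * w (a + k * s)) =
  \int[@lebesgue_measure R]_(s in `[a, a + k]) w s.
Proof.
rewrite le_eqVlt => /predU1P[<- _|k0 wc].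
  (* For [k = 0] the substitution is not strictly increasing, but both integrals vanish. *)
  rewrite addr0 set_itv1 Rintegral_set1 /Rintegral.
  by under eq_integral do rewrite mul0r; rewrite integral0.
have := @integration_by_substitution_increasing R (fun s => a + k * s) w 0 1 ler01.
rewrite mulr0 mulr1 addr0 affine_derive1 => h.
rewrite /Rintegral h//.
- by congr fine; apply: eq_integral => s _ /=; rewrite mulrC.
- by move=> x y _ _ xy; rewrite ltrD2l ltr_pM2l.
- by move=> x _; exact: cvg_cst.
- exact: is_cvg_cst.
- exact: is_cvg_cst.
- split.
  + by move=> x _; apply: derivableD => //; apply: derivableM.
  + apply: cvg_at_right_filter; exact: affine_continuous.
  + apply: cvg_at_left_filter; exact: affine_continuous.
Qed.

Lemma smooth_on_continuous (R : realType) (n : nat) (V : normedModType R)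
    (A : set 'rV[R]_n) (f : 'rV[R]_n -> V) :
  smooth_on A f -> {within A, continuous f}.
Proof.
move=> sf; apply/subspace_continuousP => x Ax.
have [F [U [oU Ux sF FE]]] := sf x Ax.
have cF : F y @[y --> x] --> f x.
  by rewrite -(FE x Ax Ux); apply: differentiable_continuous; exact: (sF [::]).
move=> W /cF FW; rewrite /within/=.
have nU : nbhs x U by exact: open_nbhs_nbhs.
apply: (@filterS2 _ (nbhs x) _ _ _ _ _ nU FW) => y Uy /=.
by move=> + Ay; rewrite FE.
Qed.

Section Speed.
Context (R : realType) (n : nat) (X : smooth_manifold R n).
Context (g : riemannian_metric X).
Implicit Types (c : chart R n X) (u : R -> 'rV[R]_n).

Definition speed c u (t : R) : R :=
  Num.sqrt ((derive1 u t *m gram g c (u t) *m (derive1 u t)^T) ord0 ord0).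

Lemma quadratic_form_cvg (T : Type) (F : set_system T) (FF : Filter F)
    (v : T -> 'rV[R]_n) (A : T -> 'M[R]_n) (v0 : 'rV[R]_n) (A0 : 'M[R]_n) :
  v @ F --> v0 -> A @ F --> A0 ->
  (v t *m A t *m (v t)^T) ord0 ord0 @[t --> F] -->
    (v0 *m A0 *m v0^T) ord0 ord0.
Proof.
move=> vv AA.
have E (w : 'rV[R]_n) (B : 'M[R]_n) : (w *m B *m w^T) ord0 ord0 =
    \sum_j (\sum_i w ord0 i * B i j) * w ord0 j.
  by rewrite mxE; apply: eq_bigr => j _; rewrite !mxE.
rewrite E; under eq_fun do rewrite E.
have cv j : v t ord0 j @[t --> F] --> v0 ord0 j.
  apply: (@cvg_comp _ _ _ v (fun w : 'rV[R]_n => w ord0 j) _ _ _ vv).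
  exact: coord_continuous.
have cA i j : A t i j @[t --> F] --> A0 i j.
  apply: (@cvg_comp _ _ _ A (fun w : 'M[R]_n => w i j) _ _ _ AA).
  exact: coord_continuous.
have cs (I : finType) (f : I -> T -> R) (l : I -> R) :
    (forall i, f i t @[t --> F] --> l i) ->
    \sum_i f i t @[t --> F] --> \sum_i l i.
  by move=> fl; apply: cvg_big => //; exact: add_continuous.
apply: (cs) => j; apply: cvgM => //; apply: (cs) => i; exact: cvgM.
Qed.

Lemma speed_continuous c u : atlas c -> C1_arc c u ->
  {within `[0, 1], continuous (speed c u)}.
Proof.
move=> ac [uim du cdu]; apply/subspace_continuousP => t t01.
apply: continuous_cvg; first exact: sqrt_continuous.
apply: quadratic_form_cvg.
  by move/subspace_continuousP : cdu; exact.
have /subspace_continuousP cg := smooth_on_continuous (gram_smooth g ac).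
move=> W /(cg _ (uim _ t01)); rewrite /within/= => gW.
have cu : u s @[s --> t] --> u t.
  by apply/differentiable_continuous/derivable1_diffP; exact: du.
apply: (@filterS _ (nbhs t) _ _ _ _ (cu _ gW)) => s h s01.
by apply: h; exact: uim.
Qed.

(** The sign of [k] is free: [k = -1] reverses an arc, and [k = 0] occurs when an arc is cut at an
    endpoint. *)
Lemma C1_arc_reparam c u (a k : R) : C1_arc c u ->
  (forall s : R, 0 <= s <= 1 -> 0 <= a + k * s <= 1) ->
  C1_arc c (fun s => u (a + k * s)).
Proof.
move=> [uim du cdu] ak.
have ak' s : `[0, 1]%classic s -> `[0, 1]%classic (a + k * s).
  by rewrite /= !in_itv; exact: ak.
split => [s /ak' /uim//|s /ak' /du h|]; first exact: (reparam_derivable h).1.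
have cu : {within `[0, 1], continuous (fun s => k *: derive1 u (a + k * s))}.
  apply/subspace_continuousP => s s01; apply: cvgZ; first exact: cvg_cst.
  by have /subspace_continuousP := within_reparam_continuous cdu ak'; exact.
apply: subspace_eq_continuous cu => s; rewrite inE => /ak' /du h.
by rewrite /from_subspace (reparam_derivable h).2.
Qed.

Lemma speed_reparam c u (a k s : R) : derivable u (a + k * s) 1 ->
  speed c (fun s => u (a + k * s)) s = `|k| * speed c u (a + k * s).
Proof.
move=> h; rewrite /speed (reparam_derivable h).2 linearZ /= -!scalemxAl -scalemxAr.
by rewrite scalerA mxE sqrtrM ?sqr_ge0// -expr2 sqrtr_sqr.
Qed.

Lemma arc_length_reparam c u (a k : R) : C1_arc c u ->
  (forall s : R, 0 <= s <= 1 -> 0 <= a + k * s <= 1) ->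
  arc_length g c (fun s => u (a + k * s)) =
  \int[@lebesgue_measure R]_(s in `[0, 1]) (`|k| * speed c u (a + k * s)).
Proof.
move=> [_ du _] ak; apply: eq_Rintegral => s; rewrite inE /= in_itv /= => /ak s01.
by apply: speed_reparam; apply: du; rewrite /= in_itv.
Qed.

Lemma arc_length_ge0 c u : 0 <= arc_length g c u.
Proof. by apply: Rintegral_ge0 => t _; exact: sqrtr_ge0. Qed.

Lemma arc_length_reverse c u : atlas c -> C1_arc c u ->
  arc_length g c (fun s => u (1 + -1 * s)) = arc_length g c u.
Proof.
move=> ac Cu; rewrite arc_length_reparam//; last by move=> s; lra.
have := @Rintegration_by_substitution_onem R (speed c u) 1.
rewrite lexx ler01 /unstable.onem subrr => /(_ isT (speed_continuous ac Cu)) h.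
apply: etrans (esym h).
by apply: eq_Rintegral => s _; rewrite normrN1 mul1r mulN1r.
Qed.

Lemma speed_integrable c u : atlas c -> C1_arc c u ->
  (@lebesgue_measure R).-integrable `[0, 1] (EFin \o speed c u).
Proof.
move=> ac Cu; apply: continuous_compact_integrable; first exact: segment_compact.
exact: speed_continuous.
Qed.

Lemma arc_length_initial c u (t : R) : atlas c -> C1_arc c u -> 0 <= t <= 1 ->
  arc_length g c (fun s => u (0 + t * s)) =
  \int[@lebesgue_measure R]_(s in `[0, t]) speed c u s.
Proof.
move=> ac Cu t01; have /andP[t0 t1] := t01.
rewrite arc_length_reparam//; last first.
  by move=> s /andP[s0 s1]; rewrite add0r mulr_ge0//= mulr_ile1.
rewrite ger0_norm// Rintegral_reparam// add0r//.
apply: continuous_subspaceW (speed_continuous ac Cu) => s /=.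
by rewrite !in_itv/= => /andP[-> /le_trans]; exact.
Qed.

Lemma arc_length_final c u (t : R) : atlas c -> C1_arc c u -> 0 <= t <= 1 ->
  arc_length g c (fun s => u (t + (1 - t) * s)) =
  \int[@lebesgue_measure R]_(s in `[t, 1]) speed c u s.
Proof.
move=> ac Cu t01; have /andP[t0 t1] := t01.
rewrite arc_length_reparam//; last first.
  move=> s /andP[s0 s1].
  have : 0 <= (1 - t) * s by rewrite mulr_ge0// subr_ge0.
  have : (1 - t) * s <= (1 - t) * 1 by rewrite ler_wpM2l// subr_ge0.
  by move=> *; lra.
rewrite ger0_norm ?subr_ge0// Rintegral_reparam ?subr_ge0// subrKC//.
apply: continuous_subspaceW (speed_continuous ac Cu) => s /=.
by rewrite !in_itv/= => /andP[/(le_trans t0) -> ->].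
Qed.

(** The length of the piece over [[0, t]] is continuous in [t] and runs from 0 to the full length,
    so some [t] gives exactly [s]; both pieces are then reparametrized affinely over [[0, 1]]. *)
Lemma arc_split c u (s : R) : atlas c -> C1_arc c u ->
  0 <= s <= arc_length g c u ->
  exists u1 u2, [/\ C1_arc c u1, C1_arc c u2, u1 0 = u 0, u1 1 = u2 0 & u2 1 = u 1] /\
    arc_length g c u1 = s /\ arc_length g c u2 = arc_length g c u - s.
Proof.
move=> ac Cu s01.
have sI := speed_integrable ac Cu.
pose L t := \int[@lebesgue_measure R]_(r in `[0, t]) speed c u r.
have Lc : {within `[0, 1], continuous L} by exact: parameterized_integral_continuous.
have L0 : L 0 = 0 by rewrite /L set_itv1 Rintegral_set1.
have L1 : L 1 = arc_length g c u by [].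
have [|t t01 Lt] := IVT ler01 Lc (v := s).
  by rewrite L0 L1 min_l ?max_r// arc_length_ge0.
move: (t01); rewrite in_itv/= => /andP[t0 t1].
exists (fun r => u (0 + t * r)), (fun r => u (t + (1 - t) * r)); split.
  split.
  - apply: C1_arc_reparam Cu _ => r /andP[r0 r1].
    by rewrite add0r mulr_ge0//= mulr_ile1.
  - apply: C1_arc_reparam Cu _ => r /andP[r0 r1].
    have : 0 <= (1 - t) * r by rewrite mulr_ge0// subr_ge0.
    have : (1 - t) * r <= (1 - t) * 1 by rewrite ler_wpM2l// subr_ge0.
    by move=> *; lra.
  - by rewrite mulr0 addr0.
  - by rewrite add0r mulr1 mulr0 addr0.
  - by rewrite mulr1 subrKC.
split; first by rewrite arc_length_initial// t0.
rewrite arc_length_final ?t0//.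
have := Rintegral_itvB sI (x := t); rewrite !bnd_simp => /(_ t0 t1).
rewrite Rintegral_itv_obnd_cbnd; last first.
  apply: integrableS sI => //; apply: subset_itvr; by rewrite bnd_simp.
by move=> <-; rewrite -Lt -L1.
Qed.

End Speed.

(** * Intrinsic distance *)

Lemma mx_entry_le_norm (R : realType) (m n : nat) (A : 'M[R]_(m, n)) i j :
  `|A i j| <= `|A|.
Proof.
rewrite [leRHS]/Num.Def.normr /= mx_normrE.
exact: (le_bigmax _ (fun ij : 'I_m * 'I_n => `|A ij.1 ij.2|) (i, j)).
Qed.

Lemma quadratic_form_le (R : realType) (n : nat) (v : 'rV[R]_n) (A : 'M[R]_n) :
  (v *m A *m v^T) ord0 ord0 <= n%:R ^+ 2 * `|A| * `|v| ^+ 2.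
Proof.
have b i j : v ord0 i * A i j * v ord0 j <= `|A| * `|v| ^+ 2.
  apply: le_trans (ler_norm _) _; rewrite !normrM mulrAC mulrC expr2.
  by rewrite ler_pM ?mulr_ge0// ?ler_pM// mx_entry_le_norm.
rewrite mxE; apply: (@le_trans _ _ (\sum_(j < n) \sum_(i < n) `|A| * `|v| ^+ 2)).
  apply: ler_sum => j _; rewrite !mxE mulr_suml.
  by apply: ler_sum => i _; exact: b.
by rewrite !sumr_const card_ord -mulrnA -[leLHS]mulr_natl natrM expr2 mulrA.
Qed.

Lemma segment_derivable (R : realType) (V : normedModType R) (p v : V) (t : R) :
  derivable (fun t : R => p + t *: v) t 1 /\
  derive1 (fun t : R => p + t *: v) t = v.
Proof.
have d : is_derive t 1 (cst p + (fun t : R => t *: v)) (0 + v).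
  apply: is_deriveD; apply: DeriveDef; first exact/derivable1_diffP/differentiableZl.
  by rewrite deriveE ?diff_val ?scale1r//; exact: differentiableZl.
split; first exact: (ex_derive (is_derive := d)).
by rewrite derive1E (derive_val (is_derive := d)) add0r.
Qed.

Section Joined.
Context (R : realType) (n : nat) (X : smooth_manifold R n).
Context (g : riemannian_metric X).

Lemma joined_cat x y z a b : joined g x y a -> joined g y z b ->
  joined g x z (a + b).
Proof.
elim=> [w|c u w l ac Cu _ IH] h; first by rewrite add0r.
by rewrite -addrA; apply: joined_arc => //; exact: IH.
Qed.

Lemma joined_ge0 x y l : joined g x y l -> 0 <= l.
Proof. by elim=> // c u w l' _ _ _ h; rewrite addr_ge0// arc_length_ge0. Qed.

Lemma joined_single c u x y : atlas c -> C1_arc c u -> x = chart_inv c (u 0) ->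
  y = chart_inv c (u 1) -> joined g x y (arc_length g c u).
Proof.
move=> ac Cu -> ->; rewrite -[X in joined _ _ _ X]addr0.
by apply: joined_arc => //; exact: joined_refl.
Qed.

Lemma joined_sym x y l : joined g x y l -> joined g y x l.
Proof.
elim=> [w|c u w l' ac Cu _ IH]; first exact: joined_refl.
rewrite addrC; apply: joined_cat IH _; rewrite -(arc_length_reverse g ac Cu).
apply: joined_single => //.
- by apply: C1_arc_reparam Cu _ => s; lra.
- by rewrite mulr0 addr0.
- by rewrite mulr1 subrr.
Qed.

(** Induction on the chain of arcs: the cut falls into the first arc or into the rest. This is what
    makes the intrinsic distance almost a length metric. *)
Lemma joined_split x y l s : joined g x y l -> 0 <= s <= l ->
  exists m, joined g x m s /\ joined g m y (l - s).
Proof.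
move=> j; elim: j s => {x y l} [x|c u y l ac Cu j IH] s /andP[s0 sl].
  have -> : s = 0 by lra.
  by exists x; rewrite subr0; split; exact: joined_refl.
have [sa|sa] := leP s (arc_length g c u).
  have [|u1 [u2 [[C1 C2 u10 u12 u21] [l1 l2]]]] := arc_split (g := g) (s := s) ac Cu.
    by rewrite s0.
  exists (chart_inv c (u1 1)); split.
    by rewrite -l1; apply: joined_single => //; rewrite u10.
  rewrite addrAC -l2; apply: joined_cat j.
  by apply: joined_single => //; rewrite ?u12 ?u21.
have [|m [m1 m2]] := IH (s - arc_length g c u); first by lra.
exists m; split.
  by rewrite -(subrKC (arc_length g c u) s); exact: joined_arc.
by have -> : arc_length g c u + l - s = l - (s - arc_length g c u) by lra.
Qed.

Lemma half_space_segment (p q : 'rV[R]_n) (t : R) : 0 <= t <= 1 ->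
  half_space (n := n) p -> half_space (n := n) q ->
  half_space (n := n) (p + t *: (q - p)).
Proof.
move=> /andP[t0 t1] hp hq i i0; rewrite !mxE.
have := mulr_ge0 (_ : 0 <= 1 - t) (hp i i0).
have := mulr_ge0 t0 (hq i i0); rewrite subr_ge0 => h /(_ t1) h'.
by lra.
Qed.

(** In a chart, [x] is joined to nearby points by straight segments, which stay in the chart image
    even at the boundary because half-spaces are convex. The Gram matrix is bounded near [x], so
    their lengths are at most a constant times the coordinate distance. *)
Lemma joined_local (x : X) (e : R) : 0 < e ->
  \forall y \near x, exists2 l, l < e & joined g x y l.
Proof.
move=> e0; have [c ac xc] := atlas_cover x.
have [dom_open [W W_open imE] [im_sub _ cK _ [cmap _]]] := atlas_chart ac.
set p := chart_map c x.
have pim : chart_im c p by exists x.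
have Wp : W p by move: pim; rewrite imE => -[].
have /subspace_continuousP cg := smooth_on_continuous (gram_smooth g ac).
set K := `|gram g c p| + 1.
have gK : \forall q \near p, chart_im c q -> `|gram g c q| <= K.
  have : `|gram g c q| @[q --> within (chart_im c) (nbhs p)] --> `|gram g c p|.
    by apply: cvg_norm; exact: cg.
  move=> /cvgrPdist_lt /(_ 1 ltr01) hq.
  apply: (@filterS _ (nbhs p) _ _ _ _ hq) => q h qc.
  by have := h qc; rewrite ltr_norml /K => /andP[? ?]; lra.
have K0 : 0 < K by rewrite ltr_wpDl.
pose C := Num.sqrt (n%:R ^+ 2 * K).
have C0 : 0 <= C by exact: sqrtr_ge0.
have : \forall q \near p, W q /\ (chart_im c q -> `|gram g c q| <= K).
  by near=> q; split; near: q => //; exact: open_nbhs_nbhs.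
move=> /nbhs_ballP[d /= d0 dP].
(* The first bound keeps segments where the Gram matrix is controlled, the second makes them shorter
   than [e]; adding 1 keeps the denominator positive. *)
pose r := Num.min d (e / (C + 1)).
have r0 : 0 < r by rewrite lt_min d0 divr_gt0//; lra.
have : \forall y \near x, chart_dom c y /\ ball p r (chart_map c y).
  have dx : nbhs x (chart_dom c) by exact: open_nbhs_nbhs.
  have := (subspace_continuousP _ _).1 cmap x xc _ (nbhsx_ballx p _ r0).
  rewrite /within/= => bx.
  by apply: (@filterS2 _ (nbhs x) _ _ _ _ _ dx bx) => y dy qy; split => //; exact: qy.
apply: filterS => y [yc]; set q := chart_map c y => qr.
have qim : chart_im c q by exists y.
pose u (t : R) := p + t *: (q - p).
have norm_qp : `|q - p| < r by move: qr; rewrite -ball_normE /= distrC.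
have uball t : 0 <= t <= 1 -> ball p d (u t).
  move=> /andP[t0 t1]; rewrite -ball_normE /= /u opprD addNKr normrN normrZ ger0_norm//.
  have : t * `|q - p| <= 1 * `|q - p| by rewrite ler_wpM2r.
  by move: norm_qp; rewrite /r lt_min => /andP[? _] ?; lra.
have uim t : 0 <= t <= 1 -> chart_im c (u t).
  move=> t01; rewrite imE; split; first exact: (dP _ (uball _ t01)).1.
  by apply: half_space_segment => //; [move: pim|move: qim]; rewrite imE => -[].
have Cu : C1_arc c u.
  split => [t|t _|].
  - by rewrite /= in_itv; exact: uim.
  - exact: (segment_derivable p (q - p) t).1.
  - have -> : derive1 u = cst (q - p).
      by apply/funext => t; exact: (segment_derivable p (q - p) t).2.
    by move=> ?; exact: cvg_cst.
have len : arc_length g c u <= C * `|q - p|.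
  have -> : C * `|q - p| = \int[@lebesgue_measure R]_(t in `[0, 1]) (C * `|q - p|).
    rewrite Rintegral_cst//= lebesgue_measure_itv/= lte_fin ltr01 -EFinD/=.
    by rewrite subr0 mulr1.
  apply: le_Rintegral => //.
  - exact: (speed_integrable g ac Cu).
  - apply: continuous_compact_integrable; first exact: segment_compact.
    by move=> ?; exact: cvg_cst.
  move=> t; rewrite /= in_itv /= => t01.
  rewrite (segment_derivable p (q - p) t).2 -[`|q - p|]ger0_norm// -sqrtr_sqr.
  have nK : 0 <= n%:R ^+ 2 * K by rewrite mulr_ge0 ?sqr_ge0// ltW.
  rewrite -sqrtrM//; apply: ler_wsqrtr.
  apply: le_trans (quadratic_form_le _ _) _.
  rewrite ler_wpM2r ?sqr_ge0// ler_wpM2l ?sqr_ge0//.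
  exact: (dP _ (uball _ t01)).2 (uim _ t01).
exists (arc_length g c u).
  apply: le_lt_trans len _.
  have h : `|q - p| < e / (C + 1) by move: norm_qp; rewrite /r lt_min => /andP[].
  have : (C + 1) * `|q - p| < e.
    by rewrite mulrC -ltr_pdivlMr//; lra.
  by have := normr_ge0 (q - p); lra.
apply: joined_single => //.
- by rewrite /u scale0r addr0 cK// inE.
- by rewrite /u scale1r subrKC cK// inE.
Unshelve. all: by end_near. Qed.

(** The set of points reachable from [x] is open and closed by [joined_local], hence everything by
    connectedness. Thus the infimum in [intrinsic_dist] is never the default value of an empty
    set. *)
Lemma all_joined (x y : X) : exists l, joined g x y l.
Proof.
pose S := [set y | exists l, joined g x y l].
have Snear z w : (exists l, joined g z w l) -> S z -> S w.
  by move=> [a za] [b xz]; exists (b + a); exact: joined_cat za.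
have near_z (z : X) : \forall w \near z, exists l, joined g z w l.
  by apply: filterS (joined_local z ltr01) => w [l _ h]; exists l.
have oS : open S.
  rewrite openE => z Sz; apply: filterS (near_z z) => w /Snear; exact.
have cS : closed S.
  rewrite -[S]setCK; apply: open_closedC; rewrite openE => z nSz.
  apply: filterS (near_z z) => w [l zw] Sw; apply: nSz.
  by apply: Snear Sw; exists l; exact: joined_sym.
suff SE : S = [set: X] by have : S y by rewrite SE.
apply: (@manifold_connected _ _ X).
- by exists x; exists 0; exact: joined_refl.
- by exists S => //; rewrite setTI.
- by exists S => //; rewrite setTI.
Qed.

Let len_set_ne x y : [set l | joined g x y l] !=set0.
Proof. by have [l] := all_joined x y; exists l. Qed.

Lemma intrinsic_dist_le x y l : joined g x y l -> intrinsic_dist g x y <= l.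
Proof. by move=> h; apply: ge_inf => //; exists 0 => ?; exact: joined_ge0. Qed.

Lemma intrinsic_dist_ge0 x y : 0 <= intrinsic_dist g x y.
Proof. by apply: lb_le_inf => // ?; exact: joined_ge0. Qed.

Lemma intrinsic_dist_lt x y e : intrinsic_dist g x y < e ->
  exists2 l, l < e & joined g x y l.
Proof. by move=> /(inf_lt (len_set_ne x y))[l h1 h2]; exists l. Qed.

Lemma intrinsic_dist_xx x : intrinsic_dist g x x = 0.
Proof.
apply/eqP; rewrite eq_le intrinsic_dist_ge0 andbT.
exact/intrinsic_dist_le/joined_refl.
Qed.

Lemma intrinsic_distC x y : intrinsic_dist g x y = intrinsic_dist g y x.
Proof.
by congr inf; apply/seteqP; split => l; exact: joined_sym.
Qed.

Lemma intrinsic_distD y x z :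
  intrinsic_dist g x z <= intrinsic_dist g x y + intrinsic_dist g y z.
Proof.
rewrite -lerBlDl; apply: lb_le_inf => // b yz.
rewrite lerBlDl -lerBlDr; apply: lb_le_inf => // a xy.
by rewrite lerBlDr; exact/intrinsic_dist_le/joined_cat/yz.
Qed.

Lemma intrinsic_dist_almost_length (x y : X) (s l : R) : 0 < s -> 0 < l ->
  intrinsic_dist g x y < s + l ->
  exists m, intrinsic_dist g x m < s /\ intrinsic_dist g m y < l.
Proof.
move=> s0 l0 /intrinsic_dist_lt[k kl xy].
have k0 := joined_ge0 xy.
(* The cut must lie strictly between [k - l] and [s]; take their midpoint, clipped to [[0, k]]. *)
have [a [a0k a_s al]] : exists a, [/\ 0 <= a <= k, a < s & k - a < l].
  have [h|h] := ltP (s + k - l) 0; first by exists 0; split; lra.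
  have [h'|h'] := ltP k ((s + k - l) / 2); first by exists k; split; lra.
  by exists ((s + k - l) / 2); split; lra.
have [m [xm my]] := joined_split xy a0k.
exists m; split; first exact: le_lt_trans (intrinsic_dist_le xm) a_s.
exact: le_lt_trans (intrinsic_dist_le my) al.
Qed.

(** By [joined_local] intrinsic balls of radius 1 are neighbourhoods, so the distance to a base
    point is locally bounded, hence bounded by compactness. *)
Lemma intrinsic_dist_bounded : compact [set: X] ->
  exists D, forall x y, intrinsic_dist g x y <= D.
Proof.
move=> cX; have [[x0]|X0] := pselect (exists x0 : X, True); last first.
  by exists 0 => x; case: X0; exists x.
move=> _; have [|D [_ DP]] := (compact_near_coveringP _).1 cX R (pinfty_nbhs R)
    (fun D y => intrinsic_dist g x0 y <= D) _.
  move=> x _; exists ([set y | intrinsic_dist g x y < 1],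
      [set D | intrinsic_dist g x0 x + 1 < D]).
    split => /=.
      apply: filterS (joined_local x ltr01) => y [l l1 xy].
      exact: le_lt_trans (intrinsic_dist_le xy) l1.
    by exists (intrinsic_dist g x0 x + 1); split => //; exact: num_real.
  move=> [y D] /= [h1 h2].
  by have := intrinsic_distD x x0 y; lra.
have {}DP y : intrinsic_dist g x0 y <= D + 1 by apply: DP => //; rewrite ltrDl.
exists (D + 1 + (D + 1)) => x y; apply: le_trans (intrinsic_distD x0 x y) _.
by rewrite (intrinsic_distC x x0) lerD.
Qed.

End Joined.

(** * Scaling and approximation *)

(** Serves for [smooth_openZ], where the iterated partials of a multiple of [F] are identified only
    on the open set on which [F] is smooth. *)
Lemma near_eq_differentiable (R : realType) (V W : normedModType R)
    (f g : V -> W) (x : V) :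
  (\near x, f x = g x) -> differentiable f x -> differentiable g x.
Proof.
move=> fg df; have fgx : f x = g x := nbhs_singleton fg.
have dc : continuous ('d f x) by exact: diff_continuous.
have E : g \o shift x = cst (g x) + 'd f x +o_ 0 id.
  apply/eqaddoP => e e0.
  have /eqaddoP/(_ e e0) := diff_locally df.
  rewrite (near_shift 0) subr0 in fg.
  apply: filterS2 fg => h /= fgh.
  by rewrite !fctE /= fgx fgh.
by apply/diff_locallyP; rewrite (diff_unique dc E).
Qed.

Lemma smooth_openZ (R : realType) (n : nat) (V : normedModType R)
    (U : set 'rV[R]_n) (F : 'rV[R]_n -> V) (a : R) : open U ->
  smooth_open U F -> smooth_open U (fun x => a *: F x).
Proof.
move=> oU sF.
have partialsE s x : U x -> partials (fun x => a *: F x) s x = a *: partials F s x.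
  elim: s x => //= i s IH x Ux.
  have -> : 'D_(delta_mx ord0 i) (partials (fun x => a *: F x) s) x =
      'D_(delta_mx ord0 i) (a \*: partials F s) x.
    apply: near_eq_derive; have nU : nbhs x U by exact: open_nbhs_nbhs.
    by apply: filterS nU => y Uy; exact: IH.
  by rewrite deriveZ//; exact/diff_derivable/sF.
move=> s x Ux.
have dF : differentiable (a \*: partials F s) x by exact/differentiableZ/sF.
apply: near_eq_differentiable dF; have nU : nbhs x U by exact: open_nbhs_nbhs.
by apply: filterS nU => y Uy; rewrite partialsE.
Qed.

Lemma smooth_onZ (R : realType) (n : nat) (V : normedModType R)
    (A : set 'rV[R]_n) (f : 'rV[R]_n -> V) (a : R) :
  smooth_on A f -> smooth_on A (fun x => a *: f x).
Proof.
move=> sf x /sf[F [U [oU Ux sF FE]]].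
exists (fun x => a *: F x), U; split=> // [|y Ay Uy]; first exact: smooth_openZ.
by rewrite FE.
Qed.

Section Scaling.
Context (R : realType) (n : nat) (X : smooth_manifold R n).
Context (g : riemannian_metric X) (k : R) (k_gt0 : 0 < k).

Let kgram (c : chart R n X) (p : 'rV[R]_n) : 'M[R]_n := k ^+ 2 *: gram g c p.

Lemma kgram_smooth c : atlas c -> smooth_on (chart_im c) (kgram c).
Proof. by move=> /(gram_smooth g)/smooth_onZ; exact. Qed.

Lemma kgram_sym c p : atlas c -> chart_im c p -> (kgram c p)^T = kgram c p.
Proof. by move=> ac pc; rewrite linearZ/= gram_sym. Qed.

Lemma kgram_pos c p (v : 'rV[R]_n) : atlas c -> chart_im c p -> v != 0 ->
  0 < (v *m kgram c p *m v^T) ord0 ord0.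
Proof.
move=> ac pc v0; rewrite -scalemxAr -scalemxAl mxE mulr_gt0 ?exprn_gt0//.
exact: gram_pos.
Qed.

Lemma kgram_compatible c c' p (F : 'rV[R]_n -> 'rV[R]_n) :
  atlas c -> atlas c' -> overlap c c' p ->
  smooth_extension (overlap c c') (transition c c') p F ->
  kgram c p = 'J F p *m kgram c' (transition c c' p) *m ('J F p)^T.
Proof.
move=> ac ac' o s; rewrite -scalemxAr -scalemxAl; congr (_ *: _).
exact: gram_compatible.
Qed.

Definition scaled_metric : riemannian_metric X :=
  RiemannianMetric kgram_smooth kgram_sym kgram_pos kgram_compatible.

Lemma arc_length_scaled c u : atlas c -> C1_arc c u ->
  arc_length scaled_metric c u = k * arc_length g c u.
Proof.
move=> ac Cu; rewrite -RintegralZl//; last exact: (speed_integrable g ac Cu).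
apply: eq_Rintegral => t _ /=.
rewrite -scalemxAr -scalemxAl mxE sqrtrM ?sqr_ge0// sqrtr_sqr ger0_norm//.
exact: ltW.
Qed.

Lemma joined_scaled x y l : joined g x y l -> joined scaled_metric x y (k * l).
Proof.
elim=> [w|c u w l' ac Cu _ IH]; first by rewrite mulr0; exact: joined_refl.
by rewrite mulrDr -arc_length_scaled//; exact: joined_arc.
Qed.

Lemma joined_unscaled x y l : joined scaled_metric x y l -> joined g x y (k^-1 * l).
Proof.
elim=> [w|c u w l' ac Cu _ IH]; first by rewrite mulr0; exact: joined_refl.
rewrite mulrDr arc_length_scaled// mulKf ?gt_eqF//; exact: joined_arc.
Qed.

Lemma intrinsic_dist_scaled x y :
  intrinsic_dist scaled_metric x y = k * intrinsic_dist g x y.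
Proof.
apply/eqP; rewrite eq_le; apply/andP; split.
  rewrite -ler_pdivrMl//; apply: lb_le_inf.
    by have [l] := all_joined g x y; exists l.
  move=> l /joined_scaled/intrinsic_dist_le; rewrite ler_pdivrMl//.
apply: lb_le_inf; first by have [l] := all_joined scaled_metric x y; exists l.
by move=> l /joined_unscaled/intrinsic_dist_le; rewrite ler_pdivlMl.
Qed.

End Scaling.

(** * The approximating metric on a compact manifold *)

Section Approximation.
Context (R : realType) (n : nat) (X : smooth_manifold R n).
Context (g : riemannian_metric X) (eta : R -> R) (Y : metricType R) (f : X -> Y).
Hypothesis eta_dist : distortion eta.
Hypothesis f_qs : quasisymmetric (intrinsic_dist g) (@mdist R Y) eta f.

Let f_bij : exists f', cancel f f' /\ cancel f' f.
Proof. by have [[f' [fK gK _ _]] _] := f_qs; exists f'. Qed.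

(** Positivity is inherited from [Y]: by continuity of [f], points at distance 0 have images at
    distance 0, and [f] is injective. *)
Lemma intrinsic_dist_eq0 x y : intrinsic_dist g x y = 0 -> x = y.
Proof.
move=> xy; have [[f' [fK _ cf _]] _] := f_qs.
apply: (can_inj fK); apply: mdist_positivity; apply/eqP.
rewrite eq_le mdist_ge0 andbT leNgt; apply/negP => /(cf x)[r r0 /(_ y)].
by rewrite xy ltxx => /(_ r0).
Qed.

Let d : metric_on R X := MetricOn (intrinsic_dist_xx g) intrinsic_dist_eq0
  (intrinsic_distC g) (intrinsic_distD g).

Lemma pullback_eq0 x y : mdist (f x) (f y) = 0 -> x = y.
Proof. by have [f' [fK _]] := f_bij; move/mdist_positivity/(can_inj fK). Qed.

Let rho : metric_on R X := MetricOn (fun x => mdistxx (f x)) pullback_eq0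
  (fun x y => metric_sym (f x) (f y)) (fun y x z => metric_triangle (f x) (f y) (f z)).

Let rho_qs x y z : x <> y -> x <> z -> y <> z ->
  rho x y / rho x z <= eta (d x y / d x z).
Proof. exact: f_qs.2. Qed.

(** Quasisymmetry against the fixed pair [x], [z] turns the bound on the intrinsic distance into one
    on the pulled-back metric. The resulting bound makes the suprema defining the modulus finite. *)
Lemma pullback_bounded (x z : X) : x <> z -> compact [set: X] ->
  exists D, forall y y', mdist (f y) (f y') <= D.
Proof.
move=> xz cX; have [E dE] := intrinsic_dist_bounded g cX.
have [eta0 _ mono _] := distortion_increasing eta_dist.
have d0 : 0 < d x z := metric_on_gt0 d xz.
have r0 : 0 < rho x z := metric_on_gt0 rho xz.
have E0 : 0 <= E / d x z.
  by rewrite divr_ge0 ?(ltW d0)//; exact: le_trans (metric_on_ge0 d x z) (dE x z).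
have e0 : 0 <= eta (E / d x z) by rewrite -eta0 mono.
pose Q := (eta (E / d x z) + 1) * rho x z.
have Q1 : rho x z <= Q by rewrite /Q ler_peMl ?(ltW r0)// lerDr.
have bd y : rho x y <= Q.
  have [<-|xy] := pselect (x = y); first by rewrite metric_onxx; lra.
  have [->//|yz] := pselect (y = z).
  have := rho_qs xy xz yz; rewrite ler_pdivrMr// => /le_trans; apply.
  rewrite ler_wpM2r ?(ltW r0)//; apply: ler_wpDr => //.
  rewrite mono//; last by rewrite divr_ge0 ?metric_on_ge0.
  by rewrite ler_wpM2r ?invr_ge0 ?(ltW d0)//; exact: dE.
exists (Q + Q) => y y'; apply: le_trans (metric_onD rho x y y') _.
by rewrite (metric_onC rho y x) lerD.
Qed.

Lemma Rloc_QS_approximation (e : R) : compact [set: X] -> 0 < e ->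
  exists2 m : metric_on R X,
    Rloc X (mspace m) /\ QS (intrinsic_dist g) (enlarged eta) (mspace m) &
    (GH_dist (mspace m) Y <= e%:E)%E.
Proof.
move=> cX e0; have [f' [fK gK]] := f_bij.
have [[x [z xz]]|noxz] := pselect (exists x z : X, x <> z); last first.
  (* With at most one point in [X], the intrinsic distance itself serves. *)
  have allE (x y : X) : x = y.
    by apply: contrapT => xy; apply: noxz; exists x, y.
  exists d; first split.
  - exists d; split => //; exists g => x.
    by exists 1; split.
  - exists idfun; split => [|x y z xy]; last by case: xy; exact: allE.
    exists idfun; split => //= x r r0; exists 1 => // y _;
      by rewrite (allE y x) ?mdistxx// intrinsic_dist_xx.
  have e2 : 0 < e / 2 by rewrite divr_gt0.
  have -> : e = 2 * (e / 2) by lra.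
  apply: (GH_dist_le gK e2) => x y.
  by rewrite (allE y x) metric_onxx mdistxx subrr normr0 ltW.
have [eta0 _ mono small] := distortion_increasing eta_dist.
have eta_ge0 (t : R) : 0 <= t -> 0 <= eta t by move=> t0; rewrite -eta0 mono.
have eta_le (s t : R) : 0 <= s -> s <= t -> eta s <= eta t.
  by move=> s0 st; rewrite mono// (le_trans s0).
have [D rD'] := pullback_bounded xz cX.
have rD y y' : rho y y' <= D := rD' y y'.
have D0 : 0 <= D by exact: le_trans (mdist_ge0 _ _) (rD x z).
have lenX (y y' : X) (s l : R) : 0 < s -> 0 < l -> d y y' < s + l ->
    exists w, d y w < s /\ d w y' < l := @intrinsic_dist_almost_length _ _ _ g y y' s l.
(* The gauge differs from [rho] by at most [eps * Num.sqrt D], and the capped metric from the gauge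
   by [2 * b <= 2 * eps]. The sum is at most [e / 2], which the gluing doubles. *)
pose eps := Num.min 1 (e / 2 / (Num.sqrt D + 2)).
have sD0 : 0 <= Num.sqrt D := sqrtr_ge0 D.
have eps0 : 0 < eps by rewrite lt_min ltr01 !divr_gt0//; lra.
have eps1 : eps <= 1 by rewrite ge_min lexx.
have epsD : eps * (Num.sqrt D + 2) <= e / 2.
  by rewrite -ler_pdivlMr; [rewrite ge_min lexx orbT|lra].
have mod_ge0 s : 0 <= modulus d rho s := modulus_ge0 d rD s.
have [s0 s00 ms0] : exists2 s, 0 < s & modulus d rho s <= eps ^+ 2.
  by apply: (modulus_vanishes lenX rho_qs eta_ge0 eta_le rD xz) => //; rewrite exprn_gt0.
pose b := eps * Num.sqrt (modulus d rho s0).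
have b0 : 0 < b.
  by rewrite mulr_gt0// sqrtr_gt0; exact: (modulus_gt0 lenX rD xz s00).
have bE : b <= eps.
  rewrite /b ler_piMr ?(ltW eps0)//; apply: le_trans eps1.
  by rewrite -[leRHS]ger0_norm ?(ltW eps0)// -sqrtr_sqr ler_wsqrtr.
(* Slope [c] and toll [2 * b] are those of [gauge_coarse_lipschitz]. As [c * s0 = 2 * b], the
   threshold of the capped metric is exactly the scale [s0], which separates [gauge_ge_small] from
   [gauge_ge_large]. *)
pose c := 2 * b / s0.
have c0 : 0 < c by rewrite divr_gt0// mulr_gt0.
have B0 : 0 < 2 * b by rewrite mulr_gt0.
pose N : metric_on R X := gauge_metric lenX rD (ltW eps0).
have NL : forall x y, N x y <= c * d x y + 2 * b.
  exact: (gauge_coarse_lipschitz lenX rD (ltW eps0) s00 ms0).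
pose m : metric_on R X := capped_metric c0 B0 NL.
have cs0 : c * s0 = 2 * b by rewrite /c divfK// gt_eqF.
have cd_le y y' : (c * d y y' <= 2 * b) = (d y y' <= s0) by rewrite -cs0 ler_pM2l.
have cd_ge y y' : (2 * b <= c * d y y') = (s0 <= d y y') by rewrite -cs0 ler_pM2l.
have comp y y' : y <> y' -> Num.min (c * d y y') (N y y') / 3 <= m y y' <=
    4 * Num.min (c * d y y') (N y y').
  move=> yy; apply: capped_comparable => //.
    rewrite cd_le => /(gauge_ge_small lenX rD (ltW eps0) yy); apply: le_trans.
    by rewrite le_eqVlt; apply/orP; left; apply/eqP; rewrite /c /b; field; exact: lt0r_neq0.
  rewrite cd_ge => /(gauge_ge_large rD (ltW eps0)); apply: le_trans.
  by rewrite /b; lra.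
exists m; first split.
- exists m; split => //; exists (scaled_metric g c0).
  have -> : intrinsic_dist (scaled_metric g c0) = fun y y' => c * d y y'.
    by apply/funext => y; apply/funext => y'; rewrite intrinsic_dist_scaled.
  exact: capped_locally_isometric.
- exists idfun; split.
    exists idfun; split => //= y r r0.
      exists (r / c); first by rewrite divr_gt0.
      move=> y' yy'; apply: (@le_lt_trans _ _ (c * d y y')).
        by rewrite /m /capped ge_min lexx.
      by rewrite mulrC -ltr_pdivlMr.
    exists (Num.min (2 * b) (c * r)); first by rewrite lt_min B0 mulr_gt0.
    move=> y'; rewrite lt_min => /andP[mB mr].
    by move: mr; rewrite [mdist _ _](capped_local (B := 2 * b))// ltr_pM2l.
  move=> u v w uv uw vw /=.
  have /andP[_ mv] := comp u v uv.
  have /andP[mw _] := comp u w uw.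
  have duw : 0 < d u w := metric_on_gt0 d uw.
  have Nuw : 0 < N u w := metric_on_gt0 N uw.
  have muw : 0 < m u w := metric_on_gt0 m uw.
  set t := d u v / d u w.
  have t0 : 0 <= t by rewrite divr_ge0 ?metric_on_ge0.
  have qN := gauge_qs lenX rho_qs eta_ge0 eta_le rD (ltW eps0) uv uw vw.
  rewrite -/t ler_pdivrMr in qN; last exact: Nuw.
  set T := eta t + _ in qN.
  have T0 : 0 <= T by rewrite addr_ge0 ?sqrtr_ge0 ?eta_ge0.
  rewrite ler_pdivrMr; last exact: muw.
  have -> : enlarged eta t = 12 * (t + T) by rewrite /enlarged /T addrA.
  (* Whichever term attains the minimum for [u], [w], the same term for [u], [v] is at most [t] or
     [T] times as large. *)
  have key : Num.min (c * d u v) (N u v) <= (t + T) * Num.min (c * d u w) (N u w).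
    have [h|h] := leP (c * d u w) (N u w).
      rewrite ge_min; apply/orP; left.
      have -> : c * d u v = t * (c * d u w) by rewrite /t; field; exact: lt0r_neq0.
      by rewrite ler_wpM2r ?lerDl// mulr_ge0 ?(ltW c0) ?(ltW duw).
    rewrite ge_min; apply/orP; right; apply: le_trans qN _.
    by rewrite ler_wpM2r ?lerDr ?(ltW Nuw).
  have h3 : (t + T) * Num.min (c * d u w) (N u w) <= (t + T) * (3 * m u w).
    by rewrite (ler_wpM2l (addr_ge0 t0 T0))//; lra.
  change (m u v <= 12 * (t + T) * m u w).
  have -> : 12 * (t + T) * m u w = 4 * ((t + T) * (3 * m u w)) by ring.
  by lra.
have e2 : 0 < e / 2 by rewrite divr_gt0.
have -> : e = 2 * (e / 2) by lra.
apply: (GH_dist_le gK e2) => y y'.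
have up : m y y' <= N y y' + 2 * b := capped_le_gauge d N c0 B0 y y'.
have lo : N y y' - 2 * b <= m y y' := capped_ge_gauge B0 NL y y'.
have NE : N y y' = mdist (f y) (f y') + eps * Num.sqrt (modulus d rho (d y y')) by [].
have s1 : 0 <= eps * Num.sqrt (modulus d rho (d y y')).
  by rewrite mulr_ge0 ?sqrtr_ge0 ?(ltW eps0).
have s2 : eps * Num.sqrt (modulus d rho (d y y')) <= eps * Num.sqrt D.
  rewrite ler_pM2l//; apply/ler_wsqrtr/modulus_le => // a a' _; exact: rD.
rewrite ler_norml; apply/andP; split; lra.
Qed.

End Approximation.

Theorem theorem1p9 (R : realType) (eta : R -> R) (eta_dist : distortion eta) :
  exists eta' : R -> R, distortion eta' /\
    forall (X : smooth_manifold R 2) (g : riemannian_metric X),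
      compact [set: X] ->
      forall Y : metricType R, QS (intrinsic_dist g) eta Y ->
        GH_closure (fun M => Rloc X M /\ QS (intrinsic_dist g) eta' M) Y.
Proof.
exists (enlarged eta); split; first exact: enlarged_distortion.
move=> X g cX Y [f fqs]; apply: (GH_closureP (X := X)) => e e0.
exact: (Rloc_QS_approximation eta_dist fqs cX e0).
Qed.
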